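(* Let $H$ be a right Hilbert module over a $C^*$-algebra and let $Q\in\mathcal{L}(H)$ be an idempotent. Then $$m(Q)=\frac{2I+|Q+Q^*|-|2I-(Q+Q^* )|}{4}.$$
   Context: $\mathcal{L}(H)$ denotes the $C^*$-algebra of all adjointable operators on $H$, $I$ is the identity operator on $H$, $T^*$ is the adjoint of $T$, and $|T|=(T^*T)^{1/2}$ is the positive square root. $Q$ is an idempotent if $Q^2=Q$, and a projection if moreover $Q^*=Q$. For $T\in\mathcal{L}(H)$ with closed range, $T^\dagger$ denotes its Moore–Penrose inverse (the unique $X\in\mathcal{L}(H)$ with $TXT=T$, $XTX=X$, $(TX)^*=TX$, $(XT)^*=XT$). The matched projection of an idempotent $Q\in\mathcal{L}(H)$ is defined by $$m(Q)=\tfrac12\big(|Q^*|+Q^*\big)|Q^*|^\dagger\big(|Q^*|+I\big)^{-1}\big(|Q^*|+Q\big)$$ (here $|Q^*|$ has closed range, so $|Q^*|^\dagger$ exists); it is a projection. *)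

(* Defs.v *)
From HB Require Import structures.
From mathcomp Require Import all_boot all_order all_algebra.
From mathcomp Require Import complex reals.
Set Implicit Arguments. Unset Strict Implicit. Unset Printing Implicit Defensive.
Import Order.TTheory GRing.Theory Num.Theory.
Local Open Scope ring_scope.

Definition ncauchy (R : realType) (V : zmodType) (N : V -> R) (u : nat -> V) :=
  forall e : R, 0 < e -> exists n0 : nat, forall m n : nat,
    (n0 <= m)%N -> (n0 <= n)%N -> N (u m - u n) < e.
Definition nconverges (R : realType) (V : zmodType) (N : V -> R) (u : nat -> V) :=
  exists l : V, forall e : R, 0 < e -> exists n0 : nat, forall n : nat,
    (n0 <= n)%N -> N (u n - l) < e.

Record cstar_algebra (R : realType) (A : lmodType R[i]) := CStarAlgebra {
  amul : A -> A -> A;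
  astar : A -> A;
  anorm : A -> R;
  amulA : forall x y z, amul x (amul y z) = amul (amul x y) z;
  amulDl : forall x y z, amul (x + y) z = amul x z + amul y z;
  amulDr : forall x y z, amul x (y + z) = amul x y + amul x z;
  amulZl : forall (c : R[i]) x y, amul (c *: x) y = c *: amul x y;
  amulZr : forall (c : R[i]) x y, amul x (c *: y) = c *: amul x y;
  astarK : forall x, astar (astar x) = x;
  astarD : forall x y, astar (x + y) = astar x + astar y;
  astarZ : forall (c : R[i]) x, astar (c *: x) = c^* *: astar x;
  astarM : forall x y, astar (amul x y) = amul (astar y) (astar x);
  anorm_eq0 : forall x, anorm x = 0 -> x = 0;
  anormD : forall x y, anorm (x + y) <= anorm x + anorm y;
  anormZ : forall (c : R[i]) x, ((anorm (c *: x))%:C)%C = `|c| * ((anorm x)%:C)%C;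
  anormM : forall x y, anorm (amul x y) <= anorm x * anorm y;
  anorm_cstar : forall x, anorm (amul (astar x) x) = anorm x ^+ 2;
  acomplete : forall u : nat -> A, ncauchy anorm u -> nconverges anorm u
}.
Arguments cstar_algebra : clear implicits.

Definition apos (R : realType) (A : lmodType R[i]) (CA : cstar_algebra R A) (a : A) :=
  exists b : A, a = amul CA (astar CA b) b.

Record hilbert_module (R : realType) (A : lmodType R[i]) (CA : cstar_algebra R A)
    (H : lmodType R[i]) := HilbertModule {
  ract : H -> A -> H;
  ip : H -> H -> A;
  ractDl : forall x y a, ract (x + y) a = ract x a + ract y a;
  ractDr : forall x a b, ract x (a + b) = ract x a + ract x b;
  ractA : forall x a b, ract (ract x a) b = ract x (amul CA a b);
  ractZl : forall (c : R[i]) x a, ract (c *: x) a = c *: ract x a;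
  ractZr : forall (c : R[i]) x a, ract x (c *: a) = c *: ract x a;
  ipDr : forall x y z, ip x (y + z) = ip x y + ip x z;
  ipZr : forall (c : R[i]) x y, ip x (c *: y) = c *: ip x y;
  ipMr : forall x y a, ip x (ract y a) = amul CA (ip x y) a;
  ip_star : forall x y, astar CA (ip x y) = ip y x;
  ip_pos : forall x, apos CA (ip x x);
  ip_eq0 : forall x, ip x x = 0 -> x = 0;
  hcomplete : forall u : nat -> H,
    ncauchy (fun x => Num.sqrt (anorm CA (ip x x))) u ->
    nconverges (fun x => Num.sqrt (anorm CA (ip x x))) u
}.
Arguments hilbert_module : clear implicits.

Section Operators.
Variables (R : realType) (A : lmodType R[i]) (CA : cstar_algebra R A)
  (H : lmodType R[i]) (HM : hilbert_module R A CA H).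

Definition is_adjoint (T Ts : H -> H) := forall x y, ip HM (T x) y = ip HM x (Ts y).
Definition adjointable (T : H -> H) := exists Ts, is_adjoint T Ts.

Definition opI : H -> H := id.
Definition opadd (S T : H -> H) : H -> H := fun x => S x + T x.
Definition opsub (S T : H -> H) : H -> H := fun x => S x - T x.
Definition opscale (c : R[i]) (T : H -> H) : H -> H := fun x => c *: T x.
Definition opmul (S T : H -> H) : H -> H := fun x => S (T x).

Definition op_pos (X : H -> H) :=
  exists S Ss, is_adjoint S Ss /\ X = opmul Ss S.

(* X = |T| = (T^star T)^{1/2}, where Ts is the adjoint of T: X is the positive
   square root of T^star T in L(H) *)
Definition is_abs (T Ts X : H -> H) := op_pos X /\ opmul X X = opmul Ts T.

Definition is_MP_inverse (T X : H -> H) :=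
  [/\ adjointable X, opmul T (opmul X T) = T, opmul X (opmul T X) = X,
      is_adjoint (opmul T X) (opmul T X) & is_adjoint (opmul X T) (opmul X T)].

Definition is_inverse (T Y : H -> H) :=
  [/\ adjointable Y, opmul Y T = opI & opmul T Y = opI].

(* m(Q) = 1/2 (|Q^star| + Q^star) |Q^star|^+ (|Q^star| + I)^{-1} (|Q^star| + Q), where
   Qs = Q^star, AQs = |Q^star|, P = |Q^star|^+ and Y = (|Q^star| + I)^{-1}. *)
Definition matched_proj_expr (Q Qs AQs P Y : H -> H) : H -> H :=
  opscale (2%:R^-1) (opmul (opadd AQs Qs) (opmul P (opmul Y (opadd AQs Q)))).

End Operators.
Arguments opI {R H}.

(* Main.v *)
(** Write a = |Q*|, p for its Moore-Penrose inverse, y for the inverse of a + I, S = Q + Q* and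
    m = m(Q). A computation gives 2 S m = (Q* + a) p (a + Q), which is self-adjoint, so S commutes
    with the symmetry J = 2m - I; hence S J = a + Q* p Q and (S - 2I) J = S J - 4m + 2I are square
    roots of S^2 and (2I - S)^2. Both are positive, and uniqueness of positive square roots
    identifies them with |S| and |2I - S|, from which m can be read off.

    Uniqueness of positive square roots: if x, z >= 0, x^2 = z^2 and d = x - z, then x d = - d z,
    so d^2 commutes with z and 0 <= d x d = - d^2 z <= 0.

    This needs that elements b* b are positive in the sense || l - b* b || <= l for some l, which
    is the notion that is visibly stable under sums. Suppose that L = || l - b* b || > l > || b ||^2
    and put v = (l - b* b) / L, r = l / L < 1, c = b v^n. Then c* c = L (r - v) v^{2n} is at most
    d = l r^{2n}; as c* c + c c* is a sum of two squares, c c* is at least - d, and so is c* c because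
    the nonzero spectra agree. Thus || c* c || <= 3 d, whereas || c* c || >= L - l since || v^k || = 1:
    a contradiction for n large. *)
From Stdlib Require Import Ncring Ncring_tac.
Require Import Defs.
From HB Require Import structures.
From mathcomp Require Import all_boot all_order all_algebra.
From mathcomp Require Import complex boolp classical_sets reals ring lra.
Set Implicit Arguments. Unset Strict Implicit. Unset Printing Implicit Defensive.
Import Order.TTheory GRing.Theory Num.Theory.
Local Open Scope ring_scope.

(** * Normalization in noncommutative rings *)

Section NoncommutativeRing.
Variable B : pzRingType.

#[global] Instance pzRing_ops :
  @Ring_ops B 0%R 1%R (@GRing.add B) (@GRing.mul B) (fun x y => x - y) (@GRing.opp B) eq := {}.

#[global] Instance pzRing_ring :
  @Ring B 0%R 1%R (@GRing.add B) (@GRing.mul B) (fun x y => x - y) (@GRing.opp B) eq pzRing_ops.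
Proof.
by split; try exact _; move=> *;
  [exact: add0r | exact: addrC | exact: addrA | exact: mul1r | exact: mulr1
  | exact: mulrA | exact: mulrDl | exact: mulrDr | | exact: subrr].
Qed.

End NoncommutativeRing.

(** Doublings [x *+ 2], hence the numeral 2, are first turned into sums that the ring normalization
    can read. *)
Ltac ncring := rewrite ?mulr2n; non_commutative_ring.

(** * Limiting arguments and power estimates for real numbers *)

Section RealLemmas.
Variable R : realType.
Implicit Types x y e : R.

Lemma le_of_forall_eps x y k : 0 <= k -> (forall e, 0 < e -> x <= y + k * e) -> x <= y.
Proof.
move=> k0 H; apply/ler_addgt0Pr => e e0.
have k1 : 0 < k + 1 by rewrite ltr_wpDl.
have /le_trans : x <= y + k * (e / (k + 1)) by apply: H; rewrite divr_gt0.
apply; rewrite lerD2l mulrCA ger_pMr// ler_pdivrMr// mul1r; lra.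
Qed.

Lemma bernoulli x n : 0 <= x -> 1 + n%:R * x <= (1 + x) ^+ n.
Proof.
move=> x0; elim: n => [|n IH]; first by rewrite mul0r addr0 expr0.
rewrite exprS -natr1; apply: (le_trans _ (ler_wpM2l _ IH)); last by lra.
have : 0 <= n%:R :> R by []. nra.
Qed.

Lemma natr_unbounded x : exists n : nat, x < n%:R.
Proof.
exists (Num.bound `|x|); apply: le_lt_trans (ler_norm x) _.
exact: archi_boundP.
Qed.

Lemma expr_lt_eps x e : 0 <= x -> x < 1 -> 0 < e -> exists n : nat, x ^+ n < e.
Proof.
move=> x0 x1 e0; have [->|xn0] := eqVneq x 0; first by exists 1%N; rewrite expr1.
have xp : 0 < x by rewrite lt_def xn0.
have [n hn] := natr_unbounded (e^-1 / (x^-1 - 1)).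
have d0 : 0 < x^-1 - 1 by rewrite subr_gt0 invf_gt1.
exists n; rewrite ltr_pdivrMr// in hn.
rewrite -[ltLHS]invrK -exprVn -[ltRHS]invrK ltf_pV2 ?posrE ?exprn_gt0 ?invr_gt0//.
have := bernoulli n (ltW d0); rewrite subrKC; lra.
Qed.

(** A factor linear in the exponent disappears on taking roots. If x = y (1 + d) with d > 0,
    Bernoulli at exponent 2 m, m = 2 ^ n, bounds (1 + d) ^ (2 m) below by (1 + m d) ^ 2. This is
    quadratic in m and exceeds 1 + 2 m k once m d ^ 2 > 2 k. *)
Lemma le_of_pow_dyadic x y k : 0 <= x -> 0 <= y -> 0 <= k ->
  (forall n, x ^+ (2 ^ n) <= y ^+ (2 ^ n) * (1 + (2 ^ n)%:R * k)) -> x <= y.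
Proof.
move=> x0 y0 k0 H; rewrite leNgt; apply/negP => yx.
have [y00|yn0] := eqVneq y 0.
  by have := H 0%N; rewrite expn0 !expr1 y00 mul0r leNgt; case/negP; rewrite -y00.
have yp : 0 < y by rewrite lt_def yn0.
set d := x / y - 1; have d0 : 0 < d by rewrite subr_gt0 ltr_pdivlMr// mul1r.
have xE : x = y * (1 + d) by rewrite /d subrKC mulrC divfK.
have [n hn] := natr_unbounded (2 * k / (d * d)).
have n2 : n%:R <= (2 ^ n)%:R :> R by rewrite ler_nat ltnW// ltn_expl.
move: (H n.+1); rewrite xE exprMn ler_pM2l ?exprn_gt0// expnS mulnC exprM.
have m0 : 0 <= (2 ^ n)%:R :> R by [].
have := bernoulli (2 ^ n) (ltW d0); rewrite natrM.
move: hn; rewrite ltr_pdivrMr ?mulr_gt0// => hn.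
set m := (2 ^ n)%:R in n2 m0 *; set b := (1 + d) ^+ _ => Hb Hb2.
have h1 : (1 + m * d) ^+ 2 <= b ^+ 2 by rewrite ler_sqr ?nnegrE; nra.
have h2 : 2 * k < m * (d * d) by apply: lt_le_trans hn _; rewrite ler_wpM2r// mulr_ge0// ltW.
have mp : 0 < m by rewrite ltr0n expn_gt0.
have h3 : 0 < m * (m * (d * d) - 2 * k) by rewrite mulr_gt0// subr_gt0.
rewrite !expr2 in h1 Hb2; nra.
Qed.

End RealLemmas.

(** * Unital C*-algebras *)

(* [sc] is the embedding of the real scalars and [im] is the scalar [i]. *)
Record ucstar (R : realType) (B : pzRingType) := UCstar {
  st : B -> B;
  nrm : B -> R;
  sc : {rmorphism R -> B};
  im : B;
  stK : forall x, st (st x) = x;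
  stD : forall x y, st (x + y) = st x + st y;
  stM : forall x y, st (x * y) = st y * st x;
  st_sc : forall r, st (sc r) = sc r;
  st_im : st im = - im;
  sc_comm : forall r x, sc r * x = x * sc r;
  im_comm : forall x, im * x = x * im;
  im_im : im * im = -1;
  nrm_eq0 : forall x, nrm x = 0 -> x = 0;
  nrmD : forall x y, nrm (x + y) <= nrm x + nrm y;
  nrm_scM : forall r x, nrm (sc r * x) = `|r| * nrm x;
  nrmM : forall x y, nrm (x * y) <= nrm x * nrm y;
  nrm_cstar : forall x, nrm (st x * x) = nrm x ^+ 2;
  ucstar_complete : forall u : nat -> B, ncauchy nrm u -> nconverges nrm u
}.

Section UnitalCstar.
Variables (R : realType) (B : pzRingType) (U : ucstar R B).
Local Notation st := (st U).
Local Notation nrm := (nrm U).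
Local Notation sc := (sc U).
Local Notation im := (im U).
Implicit Types (x y a b c t : B) (r e l k : R).

Lemma nrm0 : nrm 0 = 0.
Proof. by rewrite -[0](mul0r 0) -(rmorph0 sc) nrm_scM normr0 mul0r. Qed.

Lemma nrmN x : nrm (- x) = nrm x.
Proof. by rewrite -[LHS]mul1r -normr1 -normrN -nrm_scM rmorphN1 mulN1r opprK. Qed.

Lemma nrm_ge0 x : 0 <= nrm x.
Proof. have := nrmD U x (- x); rewrite subrr nrm0 nrmN; lra. Qed.

Lemma nrmB x y : nrm (x - y) <= nrm x + nrm y.
Proof. by rewrite -[nrm y]nrmN nrmD. Qed.

Lemma nrm_small_eq0 x k : 0 <= k -> (forall e, 0 < e -> nrm x <= k * e) -> x = 0.
Proof.
move=> k0 H; apply: (@nrm_eq0 _ _ U); apply/eqP; rewrite eq_le nrm_ge0 andbT.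
by apply: (le_of_forall_eps k0) => e e0; rewrite add0r; exact: H.
Qed.

Lemma nrm_st x : nrm (st x) = nrm x.
Proof.
have H y : nrm y <= nrm (st y).
  have := nrmM U (st y) y; rewrite nrm_cstar expr2.
  have [->|n0] := eqVneq (nrm y) 0; first by move=> _; exact: nrm_ge0.
  by rewrite ler_pM2r// lt_def n0 nrm_ge0.
by apply/eqP; rewrite eq_le H andbT -{2}[x](stK U) H.
Qed.

Lemma st0 : st 0 = 0.
Proof. by rewrite -(rmorph0 sc) st_sc. Qed.

Lemma st1 : st 1 = 1.
Proof. by rewrite -(rmorph1 sc) st_sc. Qed.

Lemma stN x : st (- x) = - st x.
Proof. by apply/eqP; rewrite -subr_eq0 opprK -stD addNr st0. Qed.

Lemma stB x y : st (x - y) = st x - st y.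
Proof. by rewrite stD stN. Qed.

Lemma nrm1_le1 : nrm 1 <= 1.
Proof.
have := nrm_cstar U 1; rewrite st1 mulr1; set n := nrm 1 => E.
rewrite leNgt; apply/negP => n1.
have : n < n ^+ 2 by rewrite expr2 ltr_pMl// (lt_trans _ n1).
by rewrite -E ltxx.
Qed.

Lemma nrm_sc r : nrm (sc r) <= `|r|.
Proof. by rewrite -[sc r]mulr1 nrm_scM ler_piMr// nrm1_le1. Qed.

Lemma sc2M x : sc 2 * x = x + x.
Proof. by rewrite rmorph_nat mulr_natl mulr2n. Qed.

Lemma sc_half x : sc 2^-1 * (x + x) = x.
Proof.
have h : 2^-1 * 2 = 1 :> R by rewrite mulVf ?pnatr_eq0.
by rewrite -sc2M mulrA -rmorphM/= h rmorph1 mul1r.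
Qed.

Lemma nrm_sa_sq x : st x = x -> nrm (x * x) = nrm x ^+ 2.
Proof. by move=> xs; rewrite -{1}xs nrm_cstar. Qed.

Lemma st_exp x n : st (x ^+ n) = st x ^+ n.
Proof. by elim: n => [|n IH]; rewrite ?st1// exprS stM IH -exprSr. Qed.

Lemma nrm_sa_dyadic x n : st x = x -> nrm (x ^+ (2 ^ n)) = nrm x ^+ (2 ^ n).
Proof.
move=> xs; elim: n => [|n IH]; first by rewrite expn0 !expr1.
by rewrite expnS mulnC !exprM !expr2 nrm_sa_sq ?st_exp ?xs// IH.
Qed.

Lemma nrm_exp x n : nrm (x ^+ n) <= nrm x ^+ n.
Proof.
elim: n => [|n IH]; first by rewrite !expr0 nrm1_le1.
by rewrite !exprS (le_trans (nrmM _ _ _))// ler_wpM2l// nrm_ge0.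
Qed.

(** The root is 1 minus a fixed point of [f], reached by iterating from 0. On the ball of radius [T]
    < 1 the map contracts by the factor [T], and self-adjointness and commutation pass to the
    limit. *)
Lemma sqrt_one_sub t : st t = t -> nrm t < 1 ->
  exists g, [/\ st g = g, g * g = 1 - t & forall c, c * t = t * c -> c * g = g * c].
Proof.
move=> ts t1; set T := nrm t in t1; have T0 : 0 <= T := nrm_ge0 t.
pose f x := sc 2^-1 * (t + x * x).
(* [1 - f x] is half of [(1 - t) + (1 - x ^ 2)], so fixed points of [f] satisfy [(1 - x) ^ 2 = 1 - t] *)
pose s n := iter n f 0.
have fB x y : nrm (f x - f y) <= 2^-1 * ((nrm x + nrm y) * nrm (x - y)).
  have -> : f x - f y = sc 2^-1 * (x * (x - y) + (x - y) * y) by rewrite /f; ncring.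
  rewrite nrm_scM gtr0_norm ?invr_gt0// ler_pM2l ?invr_gt0//.
  apply: le_trans (nrmD _ _ _) _; rewrite [leRHS]mulrDl; apply: lerD; first exact: nrmM.
  by rewrite mulrC nrmM.
have sT n : nrm (s n) <= T.
  elim: n => [|n IH]; first by rewrite /s/= nrm0.
  rewrite /s/= -/(s n) nrm_scM gtr0_norm ?invr_gt0//.
  have := nrmD U t (s n * s n); have := nrmM U (s n) (s n); have := nrm_ge0 (s n).
  by rewrite -/T; nra.
have sB n (k : nat) : nrm (s (n + k)%N - s n) <= T ^+ n.
  elim: n => [|n IH]; first by rewrite add0n subr0 expr0 (le_trans (sT _))// ltW.
  rewrite addSn /s/= -/(s n) -/(s (n + k)%N) (le_trans (fB _ _))// exprS.
  have := sT n; have := sT (n + k)%N; have := nrm_ge0 (s (n + k)%N - s n).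
  have := nrm_ge0 (s n); have := nrm_ge0 (s (n + k)%N).
  move: IH; move: (nrm _) (nrm _) (nrm _) (T ^+ n) => p q w z; nra.
have Cau : ncauchy nrm s.
  move=> e e0; have [n0 hn0] := expr_lt_eps T0 t1 (divr_gt0 e0 (ltr0Sn _ 1)).
  exists n0 => m n hm hn.
  have := nrmB (s m - s n0) (s n - s n0); rewrite opprB addrA subrK.
  have := sB n0 (m - n0)%N; have := sB n0 (n - n0)%N; rewrite !subnKC//; lra.
have [g hg] := ucstar_complete Cau.
(* Each property of the limit [g] is stated as the vanishing of an element whose norm is controlled
   by the distances of [s n] and [s n.+1] from [g]. *)
have lim0 x k : 0 <= k -> (forall n, nrm x <= k * (nrm (s n - g) + nrm (s n.+1 - g))) -> x = 0.
  move=> k0 H; apply: (@nrm_small_eq0 x (k * 2)) => [|e e0]; first by rewrite mulr_ge0.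
  have [n0 h] := hg e e0; apply: le_trans (H n0) _.
  by rewrite -mulrA ler_wpM2l// mulrDl mul1r; have := h n0 (leqnn _); have := h n0.+1 (leqnSn _); lra.
have gT : nrm g <= 2.
  have [n0 h] := hg 1 ltr01.
  have := nrmB (s n0) (s n0 - g); rewrite opprB addrC subrK.
  have := h n0 (leqnn _); have := sT n0; lra.
have gE : g - f g = 0.
  apply: (lim0 _ 2) => // n.
  have -> : g - f g = (f (s n) - f g) - (s n.+1 - g) by rewrite /s/=; ncring.
  have := nrmB (f (s n) - f g) (s n.+1 - g); have := fB (s n) g; have := sT n.
  have := nrm_ge0 (s n - g); have := nrm_ge0 (s n.+1 - g); have := nrm_ge0 (s n).
  by move: gT; move: (nrm _) (nrm _) (nrm _) (nrm _) (nrm _) => *; nra.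
have gs : st g - g = 0.
  apply: (lim0 _ 2) => // n.
  have ss : st (s n) = s n.
    elim: n => [|n IH]; rewrite /s/= ?st0// -/(s n).
    by rewrite stM st_sc -sc_comm stD stM ts IH.
  have -> : st g - g = (s n - g) - st (s n - g) by rewrite stB ss; ncring.
  have := nrmB (s n - g) (st (s n - g)); rewrite nrm_st.
  have := nrm_ge0 (s n.+1 - g); lra.
have gc c : c * t = t * c -> c * g - g * c = 0.
  move=> ct; apply: (lim0 _ (2 * nrm c)) => [|n]; first by rewrite mulr_ge0 ?nrm_ge0.
  have cs : c * s n = s n * c.
    elim: n => [|n IH]; rewrite /s/= ?mulr0 ?mul0r// -/(s n) /f.
    by rewrite mulrA -sc_comm -!mulrA; congr (_ * _);
      rewrite mulrDr mulrDl ct -!mulrA -IH !mulrA IH.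
  have -> : c * g - g * c = (s n - g) * c - c * (s n - g) by rewrite mulrBl mulrBr cs; ncring.
  have := nrmB ((s n - g) * c) (c * (s n - g)).
  have := nrmM U (s n - g) c; have := nrmM U c (s n - g).
  have := nrm_ge0 (s n.+1 - g); have := nrm_ge0 (s n - g); have := nrm_ge0 c; nra.
exists (1 - g); split => [||c ct].
- by rewrite stB st1 (subr0_eq gs).
- have E : g + g = t + g * g by rewrite {1 2}(subr0_eq gE) /f -mulrDr sc_half.
  have -> : (1 - g) * (1 - g) = 1 - (g + g) + g * g by ncring.
  by rewrite E; ncring.
- by rewrite mulrBr mulrBl mulr1 mul1r (subr0_eq (gc c ct)).
Qed.

(* [x + i y] is a scalar multiple of a unitary *)
Lemma nrm_sq_sum x y r : st x = x -> st y = y -> x * y = y * x ->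
  x * x + y * y = sc r -> nrm x ^+ 2 <= `|r|.
Proof.
move=> xs ys xy E; set u := x + im * y.
have us : st u = x - im * y by rewrite stD stM st_im xs ys mulrN im_comm.
have uu : st u * u = sc r.
  rewrite us -E /u.
  have -> : (x - im * y) * (x + im * y) = x * x + x * im * y - im * y * x - im * y * im * y by ncring.
  rewrite -[x * im]im_comm -!mulrA xy addrK [y * (im * y)]mulrA -im_comm -!mulrA.
  by rewrite [im * (im * _)]mulrA im_im mulN1r opprK.
have xu : x = sc 2^-1 * (u + st u) by rewrite us /u addrACA addrN addr0 sc_half.
have hx : nrm x <= nrm u.
  rewrite {1}xu nrm_scM gtr0_norm ?invr_gt0//.
  have := nrmD U u (st u); rewrite nrm_st; lra.
apply: le_trans (nrm_sc r); rewrite -uu nrm_cstar.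
by rewrite ler_sqr ?nnegrE ?nrm_ge0.
Qed.

(** * Positive elements: spectrum in [0, 2 l], expressed by a norm bound *)

Definition pos a := st a = a /\ exists l, nrm (sc l - a) <= l.

Lemma nrm_sub_mono a l k : nrm (sc l - a) <= l -> l <= k -> nrm (sc k - a) <= k.
Proof.
move=> h lk.
have -> : sc k - a = sc (k - l) + (sc l - a) by rewrite rmorphB/= addrA subrK.
have := nrmD U (sc (k - l)) (sc l - a); have := nrm_sc (k - l).
by rewrite ger0_norm ?subr_ge0//; lra.
Qed.

Lemma posD a b : pos a -> pos b -> pos (a + b).
Proof.
move=> [as_ [l hl]] [bs [k hk]]; split; first by rewrite stD as_ bs.
exists (l + k); rewrite rmorphD/= opprD addrACA.
by apply: le_trans (nrmD _ _ _) _; apply: lerD.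
Qed.

Lemma pos_sc r : 0 <= r -> pos (sc r).
Proof. by move=> r0; split; [exact: st_sc | exists r; rewrite subrr nrm0]. Qed.

Lemma pos_scM r a : 0 <= r -> pos a -> pos (sc r * a).
Proof.
move=> r0 [as_ [l hl]]; split; first by rewrite stM st_sc as_ sc_comm.
by exists (r * l); rewrite rmorphM/= -mulrBr nrm_scM ger0_norm// ler_wpM2l.
Qed.

Lemma pos_subr_sc a r : st a = a -> nrm a <= r -> pos (sc r - a).
Proof.
move=> as_ ar; split; first by rewrite stB st_sc as_.
by exists r; rewrite opprB addrC subrK.
Qed.

(** With y = h / k of norm below 1, g = sqrt (1 - y ^ 2) commutes with y and g ^ 2 + y ^ 2 = 1, so
    [nrm_sq_sum] gives g norm at most 1. The element in question is k ^ 2 g ^ 2. *)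
Lemma nrm_sub_sq h k : st h = h -> nrm h < k -> nrm (sc (k * k) - h * h) <= k * k.
Proof.
move=> hs hk; have k0 : 0 < k := le_lt_trans (nrm_ge0 _) hk.
pose y := sc k^-1 * h.
have ys : st y = y by rewrite stM st_sc hs -sc_comm.
have y1 : nrm y < 1.
  by rewrite nrm_scM gtr0_norm ?invr_gt0// mulrC ltr_pdivrMr// mul1r.
have [g [gs gg gc]] : exists g, [/\ st g = g, g * g = 1 - y * y &
    forall c, c * (y * y) = (y * y) * c -> c * g = g * c].
  apply: sqrt_one_sub; first by rewrite stM ys.
  by rewrite nrm_sa_sq// expr_lt1// nrm_ge0.
have g1 : nrm g ^+ 2 <= 1.
  rewrite -[leRHS]normr1; apply: (@nrm_sq_sum g y) => //.
    by rewrite gc// mulrA.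
  by rewrite gg subrK rmorph1.
have hE : h = sc k * y by rewrite /y mulrA -rmorphM/= divff ?gt_eqF// rmorph1 mul1r.
have -> : sc (k * k) - h * h = sc (k * k) * (g * g).
  rewrite gg mulrBr mulr1 hE rmorphM/=; congr (_ - _).
  by clearbody y; rewrite -!mulrA; congr (_ * _); rewrite [LHS]mulrA -[y * sc k]sc_comm -mulrA.
by rewrite nrm_scM gtr0_norm ?mulr_gt0// ger_pMr ?mulr_gt0// nrm_sa_sq.
Qed.

Lemma pos_sq h : st h = h -> pos (h * h).
Proof.
move=> hs; split; first by rewrite stM hs.
by eexists; apply: (nrm_sub_sq (k := nrm h + 1) hs); rewrite ltrDl.
Qed.

(** The shift by e gives a + e = k (1 - t) with k = l + e and t = (l - a) / k, whose norm is at most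
    l / k < 1, so [sqrt_one_sub] applies. *)
Lemma pos_sqrt a e : pos a -> 0 < e -> exists g,
  [/\ st g = g, g * g = a + sc e & forall c, c * a = a * c -> c * g = g * c].
Proof.
move=> [as_ [l hl]] e0.
have l0 : 0 <= l := le_trans (nrm_ge0 _) hl.
set k := l + e; have k0 : 0 < k by rewrite ltr_wpDl.
set t := sc k^-1 * (sc l - a).
have ts : st t = t by rewrite stM stB !st_sc as_ -sc_comm.
have t1 : nrm t < 1.
  rewrite nrm_scM gtr0_norm ?invr_gt0// mulrC ltr_pdivrMr// mul1r /k; lra.
have [g [gs gg gc]] := sqrt_one_sub ts t1.
exists (sc (Num.sqrt k) * g); split => [||c ca].
- by rewrite stM st_sc gs sc_comm.
- rewrite [_ * g * _]mulrA -[_ * g * sc _]mulrA -[g * sc _]sc_comm mulrA -rmorphM/= -mulrA.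
  rewrite -expr2 sqr_sqrtr ?ltW// gg mulrBr mulr1 /t mulrA -rmorphM/= divff ?gt_eqF//.
  by rewrite rmorph1 mul1r /k rmorphD/=; ncring.
- rewrite mulrA -sc_comm -!mulrA gc// /t mulrA -sc_comm -!mulrA; congr (_ * _).
  by rewrite mulrBl mulrBr ca sc_comm.
Qed.

(** Every r above the norm can serve as the witness in [pos]. Apply [nrm_sub_sq] to a root of a + e;
    the margin r + 2 e makes the bound on its norm strict. *)
Lemma pos_nrm_le a r : pos a -> nrm a <= r -> nrm (sc r - a) <= r.
Proof.
move=> pa ar; apply: (@le_of_forall_eps _ _ _ 4) => // e e0.
have r0 : 0 <= r := le_trans (nrm_ge0 _) ar.
have [g [gs gg _]] := pos_sqrt pa e0.
have k0 : 0 <= r + 2 * e by lra.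
have kE : Num.sqrt (r + 2 * e) * Num.sqrt (r + 2 * e) = r + 2 * e by rewrite -expr2 sqr_sqrtr.
have gk : nrm g < Num.sqrt (r + 2 * e).
  rewrite -ltr_sqr ?nnegrE ?nrm_ge0 ?sqrtr_ge0// sqr_sqrtr// -nrm_sa_sq// gg.
  have := nrmD U a (sc e); have := nrm_sc e; rewrite gtr0_norm//; lra.
have := nrm_sub_sq gs gk; rewrite kE gg => H.
have -> : sc r - a = (sc (r + 2 * e) - (a + sc e)) - sc e.
  by rewrite rmorphD rmorphM/= sc2M; ncring.
have := nrmB (sc (r + 2 * e) - (a + sc e)) (sc e); have := nrm_sc e.
rewrite gtr0_norm//; lra.
Qed.

(** All approximants within distance 1 share the witness [nrm a + 1] by [pos_nrm_le], and a bound
    with a fixed witness survives the limit. *)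
Lemma pos_closed a : st a = a ->
  (forall e, 0 < e -> exists2 b, pos b & nrm (a - b) <= e) -> pos a.
Proof.
move=> as_ H; split => //; exists (nrm a + 1).
apply: (@le_of_forall_eps _ _ _ 2) => // e e0.
have [b pb ab] := H (Num.min e 1) ltac:(by rewrite lt_min e0/=).
move: ab; rewrite le_min => /andP[ae a1].
have bn : nrm b <= nrm a + 1 by have := nrmB a (a - b); rewrite opprB addrC subrK; lra.
have -> : sc (nrm a + 1) - a = (sc (nrm a + 1) - b) - (a - b) by ncring.
have := nrmB (sc (nrm a + 1) - b) (a - b); have := pos_nrm_le pb bn; lra.
Qed.

(** If f and g are commuting self-adjoint roots of a + d and b + d, the product of these shifts is
    the square of the self-adjoint f g; then let d tend to 0. *)
Lemma posM a b : pos a -> pos b -> a * b = b * a -> pos (a * b).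
Proof.
move=> pa pb ab; have [as_ _] := pa; have [bs _] := pb.
apply: pos_closed => [|e e0]; first by rewrite stM as_ bs.
set k := nrm a + nrm b + 1.
have k0 : 0 < k by have := nrm_ge0 a; have := nrm_ge0 b; rewrite /k; lra.
(* The cap 1 on d accounts for the summand 1 in [k]. *)
set d := Num.min (e / k) 1.
have d0 : 0 < d by rewrite /d lt_min divr_gt0/=.
have [f [fs ff fc]] := pos_sqrt pa d0; have [g [gs gg gc]] := pos_sqrt pb d0.
have fb : f * b = b * f by rewrite fc// ab.
have fg : f * g = g * f by rewrite gc.
exists ((a + sc d) * (b + sc d)).
  have -> : (a + sc d) * (b + sc d) = (f * g) * (f * g).
    by rewrite -ff -gg -!mulrA [g * (f * g)]mulrA -fg -!mulrA.
  by apply: pos_sq; rewrite stM fs gs.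
have -> : a * b - (a + sc d) * (b + sc d) = - (sc d * (a + b + sc d)).
  by rewrite mulrDl 2!mulrDr -[a * sc d]sc_comm; ncring.
rewrite nrmN nrm_scM gtr0_norm//.
have : nrm (a + b + sc d) <= k.
  have := nrmD U (a + b) (sc d); have := nrmD U a b; have := nrm_sc d.
  have : d <= 1 by rewrite ge_min lexx orbT.
  by rewrite gtr0_norm// /k; lra.
have : d <= e / k by rewrite ge_min lexx.
rewrite ler_pdivlMr// => h1 h2; apply: le_trans h1.
by rewrite ler_wpM2l// ltW.
Qed.

(** Commuting roots f of a + e and g of r - a + e satisfy f ^ 2 + g ^ 2 = r + 2 e, so [nrm_sq_sum]
    bounds the norm of f ^ 2 = a + e. *)
Lemma nrm_le_of_pos a r : 0 <= r -> pos a -> pos (sc r - a) -> nrm a <= r.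
Proof.
move=> r0 pa pra; apply: (@le_of_forall_eps _ _ _ 3) => // e e0.
have [f [fs ff fc]] := pos_sqrt pa e0; have [g [gs gg gc]] := pos_sqrt pra e0.
have fa : f * a = a * f.
  have -> : a = f * f - sc e by rewrite ff addrK.
  by rewrite mulrBr mulrBl mulrA sc_comm.
have fg : f * g = g * f by apply: gc; rewrite mulrBr mulrBl fa sc_comm.
have := @nrm_sq_sum f g (r + 2 * e) fs gs fg.
rewrite ff gg rmorphD rmorphM/= sc2M => /(_ ltac:(ncring)).
rewrite -nrm_sa_sq// ff ger0_norm; last by lra.
have := nrmB (a + sc e) (sc e); rewrite addrK; have := nrm_sc e; rewrite gtr0_norm//; lra.
Qed.

Lemma pos_opp_eq0 a : pos a -> pos (- a) -> a = 0.
Proof.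
move=> pa pn; apply: (@nrm_eq0 _ _ U); apply/eqP; rewrite eq_le nrm_ge0 andbT.
by apply: nrm_le_of_pos => //; rewrite rmorph0 add0r.
Qed.

(* The C-star counterpart of the equality of the nonzero spectra of [c c*] and [c* c]:
   [(k - c* c)^n = k^n - c* p c] with [p] a polynomial in [c c*] whose norm grows like [n l^n],
   and the spectral radius formula removes the factor [n]. *)
Lemma pos_st_swap c e : 0 <= e -> pos (c * st c + sc e) -> pos (st c * c + sc e).
Proof.
move=> e0 [_ [l0 hl0]].
have ws : st (st c * c) = st c * c by rewrite stM stK.
split; first by rewrite stD ws st_sc.
set l := l0 + e + 1; have l00 : 0 <= l0 := le_trans (nrm_ge0 _) hl0.
have hl := nrm_sub_mono hl0 (ltac:(rewrite /l; lra) : l0 <= l); exists l.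
set k := l - e; set u := sc k - c * st c; set w := sc k - st c * c.
have kl : `|k| <= l by rewrite ger0_norm; rewrite /k /l; lra.
have l_ge1 : 1 <= l by rewrite /l; lra.
have -> : sc l - (st c * c + sc e) = w by rewrite /w /k rmorphB/=; ncring.
have hu : nrm u <= l.
  by move: hl; have -> : sc l - (c * st c + sc e) = u by rewrite /u /k rmorphB/=; ncring.
have wc : w * st c = st c * u by rewrite mulrBl mulrBr sc_comm mulrA.
have wnc n : w ^+ n * st c = st c * u ^+ n.
  by elim: n => [|n IH]; rewrite ?expr0 ?mulr1 ?mul1r// exprS -mulrA IH mulrA wc exprS -!mulrA.
have expand n : exists2 p, w ^+ n = sc k ^+ n - st c * p * c & nrm p <= n%:R * l ^+ n.
  elim: n => [|n [p hp np]].
    by exists 0; rewrite ?mulr0 ?mul0r ?nrm0// !expr0 subr0.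
  exists (sc k * p + u ^+ n).
    have -> : w ^+ n.+1 = sc k * w ^+ n - w ^+ n * st c * c.
      by rewrite exprSr /w mulrBr -/w sc_comm mulrA.
    rewrite wnc hp exprS mulrBr mulrDr mulrDl.
    by rewrite !mulrA -[st c * sc k]sc_comm opprD addrA.
  have := nrmD U (sc k * p) (u ^+ n); rewrite nrm_scM => /le_trans; apply.
  rewrite -natr1 mulrDl mul1r lerD//.
    by rewrite exprS mulrCA ler_pM ?nrm_ge0.
  apply: le_trans (nrm_exp _ _) _; rewrite exprS -[leLHS]mul1r.
  by rewrite ler_pM ?exprn_ge0 ?nrm_ge0// lerXn2r ?nnegrE ?nrm_ge0//; lra.
have wsa : st w = w by rewrite stB st_sc ws.
apply: (@le_of_pow_dyadic _ _ _ (nrm c ^+ 2)).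
- exact: nrm_ge0.
- lra.
- by rewrite exprn_ge0 ?nrm_ge0.
move=> n; rewrite -nrm_sa_dyadic//; move: (2 ^ n)%N => {}n.
have [p -> np] := expand n.
apply: le_trans (nrmB _ _) _; rewrite mulrDr mulr1; apply: lerD.
  apply: le_trans (nrm_exp _ _) _; rewrite lerXn2r ?nnegrE ?nrm_ge0//; first lra.
  exact: le_trans (nrm_sc _) kl.
apply: le_trans (nrmM _ _ _) _.
have h1 := nrmM U (st c) p; rewrite nrm_st in h1.
apply: (@le_trans _ _ (nrm c * nrm p * nrm c)); first by rewrite ler_wpM2r ?nrm_ge0.
have -> : nrm c * nrm p * nrm c = nrm p * nrm c ^+ 2 by rewrite mulrAC -expr2 mulrC.
have -> : l ^+ n * (n%:R * nrm c ^+ 2) = n%:R * l ^+ n * nrm c ^+ 2 by ring.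
by rewrite ler_wpM2r// exprn_ge0// nrm_ge0.
Qed.

(** Twice the sum is the sum of the squares of the self-adjoint elements c + [st c] and i (c -
    [st c]). *)
Lemma pos_st_mul_add c : pos (st c * c + c * st c).
Proof.
have -> : st c * c + c * st c = sc 2^-1 * ((c + st c) * (c + st c)
    + (im * (c - st c)) * (im * (c - st c))).
  have -> : (im * (c - st c)) * (im * (c - st c)) = - ((c - st c) * (c - st c)).
    by rewrite {1}im_comm mulrA -[_ * im * im]mulrA im_im mulrN1 mulNr.
  by rewrite -[LHS]sc_half; congr (_ * _); ncring.
apply: pos_scM; first by rewrite invr_ge0.
apply: posD; apply: pos_sq; first by rewrite stD stK addrC.
by rewrite stM stB st_im stK mulrN im_comm -mulNr opprB.
Qed.

(** For the lower bound, v ^ (2 ^ n) has norm 1 by the C*-identity and is v ^ n times a power of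
    norm at most 1. *)
Lemma nrm_exp_eq1 v n : st v = v -> nrm v = 1 -> nrm (v ^+ n) = 1.
Proof.
move=> vs v1; apply/eqP; rewrite eq_le; apply/andP; split.
  by apply: le_trans (nrm_exp _ _) _; rewrite v1 expr1n.
have := nrm_sa_dyadic n vs; rewrite v1 expr1n => E.
have nn : (n <= 2 ^ n)%N by rewrite ltnW// ltn_expl.
rewrite -E -(subnKC nn) exprD; apply: le_trans (nrmM _ _ _) _.
rewrite ler_piMr ?nrm_ge0//.
by apply: le_trans (nrm_exp _ _) _; rewrite v1 expr1n.
Qed.

(** The scalar inequality (t ^ n - r ^ n) (t - r) >= 0 for t >= 0, obtained by induction: the
    expression for n + 1 is v times the one for n, plus r ^ n (v - r) ^ 2. *)
Lemma pos_power_sub v r n : pos v -> 0 <= r -> pos ((v ^+ n - sc r ^+ n) * (v - sc r)).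
Proof.
move=> pv r0; have [vs _] := pv.
have sv m : sc r ^+ m * v = v * sc r ^+ m by rewrite -rmorphXn/= sc_comm.
elim: n => [|n IH]; first by rewrite !expr0 subrr mul0r -(rmorph0 sc); exact: pos_sc.
have -> : (v ^+ n.+1 - sc r ^+ n.+1) * (v - sc r) =
    v * ((v ^+ n - sc r ^+ n) * (v - sc r)) + sc (r ^+ n) * ((v - sc r) * (v - sc r)).
  rewrite exprS exprSr -!rmorphXn/=; set p := sc (r ^+ n); set q := sc r.
  rewrite [RHS](_ : _ = (v * v ^+ n - p * q) * (v - q) + (p * v - v * p) * (v - q)).
    by rewrite (sc_comm U _ v : p * v = _) subrr mul0r addr0.
  by ncring.
apply: posD; last first.
  by apply: pos_scM; [exact: exprn_ge0 | apply: pos_sq; rewrite stB vs st_sc].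
apply: posM => //.
have cv m : (v ^+ m - sc r ^+ m) * v = v * (v ^+ m - sc r ^+ m).
  by rewrite mulrBl mulrBr sv -exprSr exprS.
by rewrite -mulrA mulrBl -[v * v]/(v * v) mulrA -cv -mulrA mulrBr sc_comm.
Qed.

Lemma pos_st_mul b : pos (st b * b).
Proof.
set h := st b * b; have hs : st h = h by rewrite stM stK.
split=> //; set l := nrm h + 1; exists l.
have l0 : 0 < l by rewrite ltr_wpDl ?nrm_ge0.
rewrite leNgt; apply/negP; set L := nrm (sc l - h) => lL.
have L0 : 0 < L := lt_trans l0 lL.
set r := l / L; have r0 : 0 <= r by rewrite divr_ge0 ?ltW.
have r1 : r < 1 by rewrite ltr_pdivrMr// mul1r.
set v := sc L^-1 * (sc l - h).
have pv : pos v.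
  apply: pos_scM; first by rewrite invr_ge0 ltW.
  by apply: pos_subr_sc => //; rewrite lerDl.
have [vs _] := pv.
have v1 : nrm v = 1 by rewrite nrm_scM gtr0_norm ?invr_gt0// mulVf ?gt_eqF.
have scr : sc r = sc L^-1 * sc l by rewrite -rmorphM/= mulrC.
have lE : l = L * r by rewrite /r mulrC divfK ?gt_eqF.
clearbody r.
have hE : h = sc L * (sc r - v).
  rewrite /v scr -mulrBr mulrA -rmorphM/= divff ?gt_eqF// rmorph1 mul1r.
  by rewrite opprB addrC subrK.
have hv : h * v = v * h.
  rewrite /v mulrA -[h * sc _]sc_comm -[LHS]mulrA -[RHS]mulrA; congr (_ * _).
  by rewrite mulrBl mulrBr sc_comm.
have key n : L - l <= 3 * l * (r ^+ n).
  pose c := b * v ^+ n; pose d := l * r ^+ (2 * n).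
  have d0 : 0 <= d by rewrite mulr_ge0 ?exprn_ge0// ltW.
  have hvn : v ^+ n * h = h * v ^+ n.
    elim: n {c d d0} => [|n IH]; first by rewrite expr0 mul1r mulr1.
    by rewrite exprS -mulrA IH mulrA -hv mulrA.
  have cE : st c * c = sc L * (sc r - v) * v ^+ (2 * n).
    rewrite /c stM st_exp vs -mulrA [st b * _]mulrA -/h mulrA hvn -mulrA -exprD addnn -mul2n.
    by rewrite {1}hE.
  have pdc : pos (sc d - st c * c).
    (* As l = L r, adding and subtracting r ^ (2 n) v splits the difference into two positive
       terms. *)
    have -> : sc d - st c * c = sc L * ((v ^+ (2 * n) - sc r ^+ (2 * n)) * (v - sc r) + sc (r ^+ (2 * n)) * v).
      rewrite cE -!mulrA /d lE !rmorphM/= -mulrA -mulrBr rmorphXn/=; congr (_ * _).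
      set w := v ^+ _; set s := sc r ^+ _.
      have sv : s * v = v * s by rewrite /s -rmorphXn/= sc_comm.
      have sr : s * sc r = sc r * s by rewrite sc_comm.
      have vw : w * v = v * w by rewrite -exprSr exprS.
      have rw : sc r * w = w * sc r by rewrite sc_comm.
      by rewrite -sr mulrBl rw -vw; ncring.
    apply: pos_scM; first exact: ltW.
    by apply: posD; [exact: pos_power_sub | apply: pos_scM => //; exact: exprn_ge0].
  have pcd : pos (st c * c + sc d).
    apply: pos_st_swap => //.
    have -> : c * st c + sc d = (st c * c + c * st c) + (sc d - st c * c) by ncring.
    by apply: posD => //; exact: pos_st_mul_add.
  have ncd : nrm (st c * c + sc d) <= 2 * d.
    apply: nrm_le_of_pos => //; first by rewrite mulr_ge0.
    have -> : sc (2 * d) - (st c * c + sc d) = sc d - st c * c by rewrite rmorphM/= sc2M; ncring.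
    exact: pdc.
  have nc : nrm (st c * c) <= 3 * d.
    have := nrmB (st c * c + sc d) (sc d); rewrite addrK; have := nrm_sc d.
    by rewrite ger0_norm//; lra.
  have : L - l <= nrm (st c * c).
    (* The powers of [v] have norm 1, so the two terms in v have norms l and L, and the remaining
       one has norm at least L - l. *)
    have e1 : sc l * v ^+ (2 * n) - st c * c = sc L * v ^+ (2 * n).+1.
      by rewrite lE cE exprS rmorphM/=; move: (v ^+ _) => w; clearbody v; ncring.
    have := nrmB (sc l * v ^+ (2 * n)) (st c * c); rewrite e1 !nrm_scM !nrm_exp_eq1// !mulr1.
    by rewrite !gtr0_norm//; lra.
  move=> /le_trans; apply; apply: le_trans nc _; rewrite /d -!mulrA ler_pM2l//.
  by rewrite ler_pM2l// ler_wiXn2l ?leq_pmull// ltW.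
have [n hn] := expr_lt_eps r0 r1 (divr_gt0 (ltac:(by rewrite subr_gt0) : 0 < L - l) (ltac:(by rewrite mulr_gt0) : 0 < 3 * l)).
by move: hn; rewrite ltNge ler_pdivrMr ?mulr_gt0// mulrC key.
Qed.

(** Replacing a by a + e / k = g ^ 2 turns the element into [st (g * c) * (g * c)]. The summand 1 in
    [k] keeps it positive when c = 0. *)
Lemma pos_conj a c : pos a -> pos (st c * a * c).
Proof.
move=> pa; have [as_ _] := pa.
apply: pos_closed => [|e e0]; first by rewrite !stM stK as_ mulrA.
set k := nrm c ^+ 2 + 1; have k0 : 0 < k by rewrite ltr_wpDl ?exprn_ge0 ?nrm_ge0.
have [g [gs gg _]] := pos_sqrt pa (divr_gt0 e0 k0).
exists (st (g * c) * (g * c)); first exact: pos_st_mul.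
have -> : st (g * c) * (g * c) = st c * (g * g) * c by rewrite stM gs -!mulrA.
have -> : st c * a * c - st c * (g * g) * c = - (sc (e / k) * (st c * c)).
  by rewrite gg mulrDr mulrDl -[st c * sc _]sc_comm; ncring.
rewrite nrmN nrm_scM nrm_cstar gtr0_norm ?divr_gt0// mulrAC ler_pdivrMr//.
by rewrite ler_pM2l// lerDl.
Qed.

Lemma st_mul_eq0 a : st a * a = 0 -> a = 0.
Proof.
move=> E; apply: (@nrm_eq0 _ _ U); apply/eqP.
by rewrite -sqrf_eq0 -nrm_cstar E nrm0.
Qed.

Lemma pos_sqrt_uniq x z : pos x -> pos z -> x * x = z * z -> x = z.
Proof.
move=> px pz E; have [xs _] := px; have [zs _] := pz.
set d := x - z; have ds : st d = d by rewrite stB xs zs.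
have xd : x * d = - (d * z) by rewrite /d mulrBr mulrBl E; ncring.
have dx : d * x = - (z * d) by rewrite /d mulrBr mulrBl E; ncring.
have zdd : z * (d * d) = d * d * z.
  by rewrite mulrA -[z * d]opprK -dx mulNr -mulrA xd mulrN opprK mulrA.
have pdxd : pos (d * x * d) by rewrite -{1}ds; exact: pos_conj.
have dxd0 : d * x * d = 0.
  apply: pos_opp_eq0 => //; rewrite -mulrA xd mulrN opprK mulrA.
  by apply: posM => //; exact: pos_sq.
(* From d x d = 0 one gets in turn z d ^ 2 = 0, d z = 0, x d ^ 2 = 0, d ^ 3 = 0; then two uses of
   the C*-identity give d ^ 2 = 0 and d = 0. *)
have zd0 : z * (d * d) = 0 by rewrite mulrA -[z * d]opprK -dx mulNr dxd0 oppr0.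
have dz0 : d * z = 0 by apply: st_mul_eq0; rewrite stM ds zs -mulrA [d * (d * z)]mulrA -zdd zd0 mulr0.
have xd0 : x * (d * d) = 0 by rewrite mulrA xd dz0 oppr0 mul0r.
have d3 : d * (d * d) = 0 by rewrite {1}/d mulrBl xd0 zd0 subr0.
have dd : d * d = 0 by apply: st_mul_eq0; rewrite stM ds -mulrA d3 mulr0.
by apply/eqP; rewrite -subr_eq0 -/d; apply/eqP/st_mul_eq0; rewrite ds.
Qed.

End UnitalCstar.

(** * Adjointable operators on a Hilbert module *)

Section CstarNorm.
Variables (R : realType) (A : lmodType R[i]) (CA : cstar_algebra R A).
Local Notation nA := (anorm CA).
Implicit Types (x y : A) (r : R).

Lemma normc_real r : `|(r%:C)%C| = (`|r|%:C)%C :> R[i].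
Proof. by rewrite normc_def/= expr0n/= addr0 sqrtr_sqr. Qed.

Lemma anormZr r x : nA ((r%:C)%C *: x) = `|r| * nA x.
Proof. by apply: complexI; rewrite anormZ normc_real -rmorphM. Qed.

Lemma anorm0 : nA 0 = 0.
Proof. by rewrite -(scale0r (0 : A)) -(rmorph0 (real_complex R)) anormZr normr0 mul0r. Qed.

Lemma anormN x : nA (- x) = nA x.
Proof. by rewrite -[- x]scaleN1r -(rmorphN1 (real_complex R)) anormZr normrN1 mul1r. Qed.

Lemma anormB x y : nA (x - y) <= nA x + nA y.
Proof. by rewrite -[nA y]anormN anormD. Qed.

Lemma anorm_ge0 x : 0 <= nA x.
Proof. have := anormB x x; rewrite subrr anorm0; lra. Qed.

Lemma anorm_star x : nA (astar CA x) = nA x.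
Proof.
have H y : nA y <= nA (astar CA y).
  have := anormM CA (astar CA y) y; rewrite anorm_cstar expr2.
  have [->|n0] := eqVneq (nA y) 0; first by move=> _; exact: anorm_ge0.
  by rewrite ler_pM2r// lt_def n0 anorm_ge0.
by apply/eqP; rewrite eq_le H andbT -{2}[x](astarK CA) H.
Qed.

Lemma astar0 : astar CA 0 = 0.
Proof. by rewrite -(scale0r (0 : A)) astarZ conjC0 !scale0r. Qed.

Lemma amulNl x y : amul CA (- x) y = - amul CA x y.
Proof. by rewrite -[- x]scaleN1r amulZl scaleN1r. Qed.

Lemma anorm_small_eq0 x k : 0 <= k -> (forall e, 0 < e -> nA x <= k * e) -> x = 0.
Proof.
move=> k0 H; apply: (@anorm_eq0 _ _ CA); apply/eqP; rewrite eq_le anorm_ge0 andbT.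
by apply: (le_of_forall_eps k0) => e e0; rewrite add0r; exact: H.
Qed.

End CstarNorm.

Section AdjointableOperators.
Variables (R : realType) (A : lmodType R[i]) (CA : cstar_algebra R A)
  (H : lmodType R[i]) (HM : hilbert_module R A CA H).
Local Notation ip := (ip HM).
Implicit Types (x y z : H).

Lemma ipDl x y z : ip (x + y) z = ip x z + ip y z.
Proof. by rewrite -ip_star ipDr astarD !ip_star. Qed.

Lemma ipZl c x y : ip (c *: x) y = c^* *: ip x y.
Proof. by rewrite -ip_star ipZr astarZ ip_star. Qed.

Lemma ip0r x : ip x 0 = 0.
Proof. by rewrite -(scale0r (0 : H)) ipZr !scale0r. Qed.

Lemma ip0l x : ip 0 x = 0.
Proof. by rewrite -ip_star ip0r astar0. Qed.

Lemma ipNr x y : ip x (- y) = - ip x y.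
Proof. by rewrite -[- y]scaleN1r ipZr scaleN1r. Qed.

Lemma ipNl x y : ip (- x) y = - ip x y.
Proof. by rewrite -[- x]scaleN1r ipZl rmorphN1 scaleN1r. Qed.

Lemma ipBr x y z : ip x (y - z) = ip x y - ip x z.
Proof. by rewrite ipDr ipNr. Qed.

Lemma ipBl x y z : ip (x - y) z = ip x z - ip y z.
Proof. by rewrite ipDl ipNl. Qed.

Lemma ip_ext x y : (forall z, ip x z = ip y z) -> x = y.
Proof.
move=> E; apply/eqP; rewrite -subr_eq0; apply/eqP/(@ip_eq0 _ _ _ _ HM).
by rewrite ipBl E subrr.
Qed.

(** * The ring of adjointable operators *)

Record aop := Aop { afun :> H -> H; aopP : adjointable HM afun }.

Lemma aop_eq (f g : aop) : (f : H -> H) = g -> f = g.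
Proof. by case: f g => f hf [g hg] /= E; subst g; congr Aop; exact: Prop_irrelevance. Qed.

HB.instance Definition _ := gen_eqMixin aop.
HB.instance Definition _ := gen_choiceMixin aop.

Lemma is_adjointC (f g : H -> H) : is_adjoint HM f g -> is_adjoint HM g f.
Proof. by move=> h x y; rewrite -ip_star -h ip_star. Qed.

Lemma is_adjointD (f g f' g' : H -> H) : is_adjoint HM f f' -> is_adjoint HM g g' ->
  is_adjoint HM (opadd f g) (opadd f' g').
Proof. by move=> hf hg x y; rewrite ipDl ipDr hf hg. Qed.

Lemma is_adjointM (f g f' g' : H -> H) : is_adjoint HM f f' -> is_adjoint HM g g' ->
  is_adjoint HM (opmul f g) (opmul g' f').
Proof. by move=> hf hg x y; rewrite /opmul hf hg. Qed.

Lemma is_adjointZ c : is_adjoint HM (opscale c opI) (opscale c^* opI).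
Proof. by move=> x y; rewrite ipZl ipZr. Qed.

Lemma is_adjoint_id : is_adjoint HM opI opI.
Proof. by []. Qed.

Lemma is_adjointN (f g : H -> H) : is_adjoint HM f g -> is_adjoint HM (fun x => - f x) (fun x => - g x).
Proof. by move=> h x y; rewrite ipNl ipNr h. Qed.

Lemma is_adjoint0 : is_adjoint HM (fun=> 0) (fun=> 0).
Proof. by move=> x y; rewrite ip0l ip0r. Qed.

(** Operators are bare functions; linearity comes from moving them across the inner product, which
    separates points. *)
Lemma is_adjoint_linear (f g : H -> H) : is_adjoint HM f g ->
  forall c x y, f (c *: x + y) = c *: f x + f y.
Proof.
by move=> h c x y; apply: ip_ext => z; rewrite h ipDl ipZl -!h -ipZl -ipDl.
Qed.

Lemma aop_linear (f : aop) c x y : f (c *: x + y) = c *: f x + f y.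
Proof. by have [g h] := aopP f; exact: is_adjoint_linear h _ _ _. Qed.

Lemma aopD (f : aop) x y : f (x + y) = f x + f y.
Proof. by have := aop_linear f 1 x y; rewrite !scale1r. Qed.

Lemma aop0 (f : aop) : f 0 = 0.
Proof. by apply: (addrI (f 0)); rewrite -aopD !addr0. Qed.

Lemma aopZ (f : aop) c x : f (c *: x) = c *: f x.
Proof. by have := aop_linear f c x 0; rewrite !addr0 aop0 addr0. Qed.

(** An [aop] carries only the existence of an adjoint, so one is chosen; [aop_stE] shows that the
    choice is immaterial. *)
Definition adj (f : aop) : H -> H := projT1 (cid (aopP f)).

Lemma adjP (f : aop) : is_adjoint HM f (adj f).
Proof. by rewrite /adj; case: cid. Qed.

Definition aop_st (f : aop) : aop := Aop (ex_intro _ (f : H -> H) (is_adjointC (adjP f))).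

Lemma aop_stP (f : aop) : is_adjoint HM f (aop_st f).
Proof. exact: adjP. Qed.

Lemma aop_stE (f : aop) (g : H -> H) : is_adjoint HM f g -> aop_st f = g :> (H -> H).
Proof.
move=> h; apply: funext => x; apply: ip_ext => z.
by rewrite -(ip_star HM z) -(ip_star HM z) -h (aop_stP f).
Qed.

Definition aop_add (f g : aop) : aop :=
  Aop (ex_intro _ _ (is_adjointD (aop_stP f) (aop_stP g))).
Definition aop_opp (f : aop) : aop := Aop (ex_intro _ _ (is_adjointN (aop_stP f))).
Definition aop_zero : aop := Aop (ex_intro _ _ is_adjoint0).
Definition aop_one : aop := Aop (ex_intro _ _ is_adjoint_id).
Definition aop_mul (f g : aop) : aop :=
  Aop (ex_intro _ _ (is_adjointM (aop_stP f) (aop_stP g))).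

Fact aop_addA : associative aop_add.
Proof. by move=> f g h; apply/aop_eq/funext => x /=; rewrite /opadd/= addrA. Qed.
Fact aop_addC : commutative aop_add.
Proof. by move=> f g; apply/aop_eq/funext => x /=; rewrite /opadd/= addrC. Qed.
Fact aop_add0 : left_id aop_zero aop_add.
Proof. by move=> f; apply/aop_eq/funext => x /=; rewrite /opadd/= add0r. Qed.
Fact aop_addN : left_inverse aop_zero aop_opp aop_add.
Proof. by move=> f; apply/aop_eq/funext => x /=; rewrite /opadd/= addNr. Qed.

HB.instance Definition _ := GRing.isZmodule.Build aop aop_addA aop_addC aop_add0 aop_addN.

Fact aop_mulA : associative aop_mul.
Proof. by move=> f g h; exact/aop_eq/funext. Qed.
Fact aop_mul1 : left_id aop_one aop_mul.
Proof. by move=> f; exact/aop_eq/funext. Qed.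
Fact aop_mulr1 : right_id aop_one aop_mul.
Proof. by move=> f; exact/aop_eq/funext. Qed.
Fact aop_mulDl : left_distributive aop_mul +%R.
Proof. by move=> f g h; exact/aop_eq/funext. Qed.
Fact aop_mulDr : right_distributive aop_mul +%R.
Proof. by move=> f g h; apply/aop_eq/funext => x; rewrite /= /opmul/= /opadd/= aopD. Qed.

HB.instance Definition _ := GRing.Zmodule_isPzRing.Build aop
  aop_mulA aop_mul1 aop_mulr1 aop_mulDl aop_mulDr.

Definition aop_sc (c : R[i]) : aop := Aop (ex_intro _ _ (is_adjointZ c)).

Fact aop_sc_additive : additive aop_sc.
Proof. by move=> c d; apply/aop_eq/funext => x; rewrite /= /opscale/= scalerBl. Qed.
Fact aop_sc_multiplicative : multiplicative aop_sc.
Proof.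
split; last by apply/aop_eq/funext => x; rewrite /= /opscale scale1r.
by move=> c d; apply/aop_eq/funext => x; rewrite /= /opmul /opscale/= scalerA.
Qed.
HB.instance Definition _ := GRing.isAdditive.Build R[i] aop aop_sc aop_sc_additive.
HB.instance Definition _ := GRing.isMultiplicative.Build R[i] aop aop_sc aop_sc_multiplicative.

Lemma aop_sc_comm c f : aop_sc c * f = f * aop_sc c.
Proof. by apply/aop_eq/funext => x; rewrite /= /opmul /opscale/= aopZ. Qed.

(** * The norm of a Hilbert module and bounded operators *)

Definition hn x := Num.sqrt (anorm CA (ip x x)).

Lemma hn_sq x : hn x ^+ 2 = anorm CA (ip x x).
Proof. by rewrite sqr_sqrtr// anorm_ge0. Qed.

Lemma hn_ge0 x : 0 <= hn x.
Proof. exact: sqrtr_ge0. Qed.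

Lemma hnZ r x : hn ((r%:C)%C *: x) = `|r| * hn x.
Proof.
apply/eqP; rewrite -(@eqrXn2 _ 2) ?mulr_ge0 ?hn_ge0// hn_sq exprMn hn_sq.
rewrite ipZl ipZr.
have -> : ((r%:C)%C : R[i])^* = (r%:C)%C by exact: conjc_real.
by rewrite !anormZr mulrA expr2.
Qed.

Lemma hn0 : hn 0 = 0.
Proof. by rewrite /hn ip0r anorm0 sqrtr0. Qed.

Lemma hn_eq0 x : hn x = 0 -> x = 0.
Proof.
move=> E; apply: (@ip_eq0 _ _ _ _ HM); apply: (@anorm_eq0 _ _ CA).
by rewrite -hn_sq E expr0n.
Qed.

Lemma hnN x : hn (- x) = hn x.
Proof. by rewrite /hn ipNl ipNr opprK. Qed.

Section NormedOperators.
(** Kept as a hypothesis to avoid a circle. For A as a module over itself it is immediate, and the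
    resulting operator algebra supplies the positivity theory that proves it for general modules. *)
Hypothesis cauchy_schwarz : forall x y, anorm CA (ip x y) <= hn x * hn y.

Lemma hnD x y : hn (x + y) <= hn x + hn y.
Proof.
rewrite -ler_sqr ?nnegrE ?addr_ge0 ?hn_ge0// hn_sq ipDl !ipDr.
have := cauchy_schwarz x y; have := cauchy_schwarz y x.
have := anormD CA (ip x x + ip x y) (ip y x + ip y y).
have := anormD CA (ip x x) (ip x y); have := anormD CA (ip y x) (ip y y).
rewrite sqrrD !hn_sq -mulr_natl; lra.
Qed.

Lemma hnB x y : hn (x - y) <= hn x + hn y.
Proof. by rewrite -[hn y]hnN hnD. Qed.

(* The Hellinger-Toeplitz theorem, by a gliding hump: a failure of boundedness gives unit vectors
   [xi n] with [hn (f (xi n))] large, and one sums [4 ^ - n] times unit vectors in the directions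
   [f (xi n)], with signs chosen so that no hump is cancelled. *)
Lemma aop_bounded (f : aop) : exists M, 0 <= M /\ forall x, hn (f x) <= M * hn x.
Proof.
apply: contrapT => unb.
have big M : 0 <= M -> exists p : H * H, [/\ hn p.1 <= 1, hn p.2 <= 1,
    M <= hn (f p.1) & anorm CA (ip (f p.1) p.2) = hn (f p.1)].
  move=> M0.
  have [x hx] : exists x, M * hn x < hn (f x).
    apply: contrapT => nx; apply: unb; exists M; split => // x.
    by rewrite leNgt; apply/negP => hx; apply: nx; exists x.
  have x0 : 0 < hn x.
    rewrite lt_def hn_ge0 andbT; apply/eqP => E.
    by move: hx; rewrite (hn_eq0 E) aop0 hn0 mulr0 ltxx.
  have fx0 : 0 < hn (f x) by apply: le_lt_trans hx; rewrite mulr_ge0 ?hn_ge0.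
  set xi := (((hn x)^-1)%:C)%C *: x.
  have fxi : hn (f xi) = (hn x)^-1 * hn (f x) by rewrite aopZ hnZ gtr0_norm ?invr_gt0.
  have fxi0 : 0 < hn (f xi) by rewrite fxi mulr_gt0 ?invr_gt0.
  exists (xi, (((hn (f xi))^-1)%:C)%C *: f xi); split => /=.
  - by rewrite hnZ gtr0_norm ?invr_gt0// mulVf ?gt_eqF.
  - by rewrite hnZ gtr0_norm ?invr_gt0// mulVf ?gt_eqF.
  - by rewrite fxi ler_pdivlMl// mulrC ltW.
  - by rewrite ipZr anormZr -hn_sq gtr0_norm ?invr_gt0// expr2 mulKf ?gt_eqF.
pose q : R := 4^-1.
have q0 : 0 < q by rewrite invr_gt0.
have qn n : 0 < q ^+ n by rewrite exprn_gt0.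
(* With this size of hump, half of q ^ n times [hn (f (w n).1)] is at least n. *)
have target_ge0 n : 0 <= 2 * n%:R * (q ^+ n)^-1 by rewrite mulr_ge0 ?mulr_ge0// invr_ge0 ltW.
have /choice [w hw] n := big _ (target_ge0 n).
pose bump n : H := ((q ^+ n)%:C)%C *: (w n).2.
pose step n y := if q ^+ n * hn (f (w n).1) <= anorm CA (ip (f (w n).1) (y + bump n))
  then y + bump n else y - bump n.
pose y := fix y n := if n is m.+1 then step m (y m) else 0.
(* The pairings with the two candidates for [y n.+1] differ by twice q ^ n [hn (f (w n).1)], so if
   one is too small the other is not. *)
have yS n : q ^+ n * hn (f (w n).1) <= anorm CA (ip (f (w n).1) (y n.+1)).
  rewrite /= /step; case: ifPn => // /negP/negP; rewrite -ltNge => lt1.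
  have [_ _ _ wE] := hw n.
  have e2 : anorm CA (ip (f (w n).1) (bump n)) = q ^+ n * hn (f (w n).1).
    by rewrite ipZr anormZr wE gtr0_norm.
  have := anormB CA (ip (f (w n).1) (y n + bump n)) (ip (f (w n).1) (y n - bump n)).
  have sum2 : y n + bump n - (y n - bump n) = bump n + bump n.
    by rewrite opprB addrC addrA subrK.
  rewrite -ipBr sum2.
  have -> : ip (f (w n).1) (bump n + bump n) = ((2 : R)%:C)%C *: ip (f (w n).1) (bump n).
    by rewrite ipDr rmorph_nat scaler_nat mulr2n.
  rewrite anormZr e2 ger0_norm//; lra.
have yB1 n : hn (y n.+1 - y n) <= q ^+ n.
  have [_ w1 _ _] := hw n.
  have b1 : hn (bump n) <= q ^+ n by rewrite hnZ gtr0_norm// ler_piMr// ltW.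
  by rewrite /= /step; case: ifP => _; rewrite addrC addKr ?hnN.
have yB n k : hn (y (n + k)%N - y n) <= 4 / 3 * (q ^+ n - q ^+ (n + k)).
  elim: k => [|k IH]; first by rewrite addn0 !subrr hn0 mulr0.
  have := hnD (y (n + k.+1)%N - y (n + k)%N) (y (n + k)%N - y n); rewrite addrA subrK.
  have := yB1 (n + k)%N; rewrite -addnS.
  have -> : q ^+ (n + k.+1) = 4^-1 * q ^+ (n + k) by rewrite addnS exprS.
  lra.
have Cau : ncauchy hn y.
  move=> e e0; have [n0 hn0'] := expr_lt_eps (ltW q0) (ltac:(rewrite /q; lra) : q < 1) (divr_gt0 e0 (ltr0Sn _ 2)).
  exists n0 => m n hm hn'.
  have := hnB (y m - y n0) (y n - y n0); rewrite opprB addrA subrK.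
  have := yB n0 (m - n0)%N; have := yB n0 (n - n0)%N; rewrite !subnKC//.
  have := qn m; have := qn n; lra.
have [l hl] : nconverges hn y := hcomplete Cau.
have [g hg] := aopP f.
have [n nbig] := natr_unbounded (hn (g l)).
have [w1 _ wbig _] := hw n.
(* The later humps contribute at most 4 / 3 q ^ (n + 1) = q ^ n / 3 and the approximation of the
   limit q ^ n / 6, so at least half of the n-th pairing survives in [l]. *)
have dl : hn (l - y n.+1) <= q ^+ n / 2.
  have [n1 h1] := hl (q ^+ n / 6) (divr_gt0 (qn n) (ltr0Sn _ 5)).
  set m := maxn n1 n.+1.
  have := h1 m (leq_maxl _ _); have := yB n.+1 (m - n.+1)%N; rewrite subnKC ?leq_maxr//.
  have := hnB (y m - y n.+1) (y m - l).
  have -> : y m - y n.+1 - (y m - l) = l - y n.+1 by rewrite opprB addrC addrA subrK.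
  have qS : q ^+ n.+1 = 4^-1 * q ^+ n by rewrite exprS.
  have := qn m; move: qS; lra.
(* The adjoint [g] bounds every such pairing by [hn (g l)], which is less than n by the choice of
   n. *)
have : anorm CA (ip (f (w n).1) l) <= hn (g l).
  rewrite hg; apply: le_trans (cauchy_schwarz _ _) _.
  by rewrite ler_piMl// hn_ge0.
have := anormB CA (ip (f (w n).1) l) (ip (f (w n).1) (l - y n.+1)).
rewrite -ipBr opprB addrC subrK.
have := cauchy_schwarz (f (w n).1) (l - y n.+1).
have h3 : hn (f (w n).1) * hn (l - y n.+1) <= hn (f (w n).1) * (q ^+ n / 2).
  by rewrite ler_wpM2l ?hn_ge0.
have := yS n; move: wbig; rewrite ler_pdivrMr//; move: h3; lra.
Qed.

Local Open Scope classical_set_scope.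

(** * The operator norm and the C*-algebra of adjointable operators *)

Definition aop_nrm (f : aop) : R := inf [set M | 0 <= M /\ forall x, hn (f x) <= M * hn x].

Local Close Scope classical_set_scope.

Lemma aop_nrm_le (f : aop) M : 0 <= M -> (forall x, hn (f x) <= M * hn x) -> aop_nrm f <= M.
Proof. by move=> M0 h; apply: ge_inf => //; exists 0 => ? []. Qed.

Lemma aop_nrm_ge0 f : 0 <= aop_nrm f.
Proof. by apply: lb_le_inf; [exact: aop_bounded | move=> ? []]. Qed.

Lemma aop_nrmP (f : aop) x : hn (f x) <= aop_nrm f * hn x.
Proof.
have [/hn_eq0 ->|x0] := eqVneq (hn x) 0; first by rewrite aop0 hn0 mulr0.
have xp : 0 < hn x by rewrite lt_def x0 hn_ge0.
rewrite -ler_pdivrMr//; apply: lb_le_inf; first exact: aop_bounded.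
by move=> M [_ h]; rewrite /= ler_pdivrMr.
Qed.

Fact aop_stK f : aop_st (aop_st f) = f.
Proof. by apply/aop_eq/aop_stE/is_adjointC/aop_stP. Qed.

Fact aop_stD f g : aop_st (f + g) = aop_st f + aop_st g.
Proof. by apply/aop_eq/aop_stE; apply: is_adjointD; exact: aop_stP. Qed.

Fact aop_stM f g : aop_st (f * g) = aop_st g * aop_st f.
Proof. by apply/aop_eq/aop_stE; apply: is_adjointM; exact: aop_stP. Qed.

Fact aop_st_sc c : aop_st (aop_sc c) = aop_sc c^*.
Proof. by apply/aop_eq/aop_stE; exact: is_adjointZ. Qed.

Definition aop_scr : {rmorphism R -> aop} := aop_sc \o real_complex R.

Fact aop_st_scr r : aop_st (aop_scr r) = aop_scr r.
Proof. by rewrite aop_st_sc; congr aop_sc; exact: conjc_real. Qed.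

Fact aop_st_im : aop_st (aop_sc 'i%C) = - aop_sc 'i%C.
Proof.
rewrite aop_st_sc -rmorphN/=; congr aop_sc.
by apply/eqP; rewrite eq_complex/= oppr0 !eqxx.
Qed.

Fact aop_scr_comm r f : aop_scr r * f = f * aop_scr r.
Proof. exact: aop_sc_comm. Qed.

Fact aop_im_im : aop_sc 'i%C * aop_sc 'i%C = -1.
Proof. by rewrite -rmorphM/= -expr2 sqr_i rmorphN1. Qed.

Fact aop_nrm_eq0 f : aop_nrm f = 0 -> f = 0.
Proof.
move=> E; apply/aop_eq/funext => x; apply: hn_eq0; apply/eqP; rewrite eq_le hn_ge0 andbT.
by have := aop_nrmP f x; rewrite E mul0r.
Qed.

Fact aop_nrmD f g : aop_nrm (f + g) <= aop_nrm f + aop_nrm g.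
Proof.
apply: aop_nrm_le => [|x]; first by rewrite addr_ge0 ?aop_nrm_ge0.
by rewrite mulrDl (le_trans (hnD _ _))// lerD// aop_nrmP.
Qed.

Fact aop_nrmM f g : aop_nrm (f * g) <= aop_nrm f * aop_nrm g.
Proof.
apply: aop_nrm_le => [|x]; first by rewrite mulr_ge0 ?aop_nrm_ge0.
apply: le_trans (aop_nrmP f (g x)) _.
by rewrite -mulrA ler_wpM2l ?aop_nrm_ge0 ?aop_nrmP.
Qed.

Fact aop_nrm_scM r f : aop_nrm (aop_scr r * f) = `|r| * aop_nrm f.
Proof.
have le s g : aop_nrm (aop_scr s * g) <= `|s| * aop_nrm g.
  apply: aop_nrm_le => [|x]; first by rewrite mulr_ge0 ?aop_nrm_ge0.
  by rewrite /= /opmul /opscale/= hnZ -mulrA ler_wpM2l// aop_nrmP.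
apply/eqP; rewrite eq_le le/=.
have [->|r0] := eqVneq r 0; first by rewrite normr0 mul0r aop_nrm_ge0.
have E : f = aop_scr r^-1 * (aop_scr r * f) by rewrite mulrA -rmorphM mulVf// rmorph1 mul1r.
by rewrite {1}E -ler_pdivlMl ?normr_gt0// -normfV le.
Qed.

Fact aop_nrm_sq_le f : aop_nrm f ^+ 2 <= aop_nrm (aop_st f * f).
Proof.
have n0 := aop_nrm_ge0 (aop_st f * f).
rewrite -[leRHS]sqr_sqrtr// ler_sqr ?nnegrE ?aop_nrm_ge0 ?sqrtr_ge0//.
apply: aop_nrm_le => [|x]; first exact: sqrtr_ge0.
rewrite -ler_sqr ?nnegrE ?mulr_ge0 ?hn_ge0 ?sqrtr_ge0// exprMn hn_sq sqr_sqrtr//.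
rewrite (aop_stP f); apply: le_trans (cauchy_schwarz _ _) _.
by rewrite mulrC [hn x ^+ 2]expr2 mulrA ler_wpM2r ?hn_ge0// (aop_nrmP (aop_st f * f)).
Qed.

Fact aop_nrm_st f : aop_nrm (aop_st f) = aop_nrm f.
Proof.
have le g : aop_nrm g <= aop_nrm (aop_st g).
  have := le_trans (aop_nrm_sq_le g) (aop_nrmM _ _); rewrite expr2.
  have [->|n0] := eqVneq (aop_nrm g) 0; first by move=> _; exact: aop_nrm_ge0.
  by rewrite ler_pM2r// lt_def n0 aop_nrm_ge0.
by apply/eqP; rewrite eq_le le andbT -{2}[f]aop_stK le.
Qed.

Fact aop_nrm_cstar f : aop_nrm (aop_st f * f) = aop_nrm f ^+ 2.
Proof.
apply/eqP; rewrite eq_le aop_nrm_sq_le andbT (le_trans (aop_nrmM _ _))//.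
by rewrite aop_nrm_st expr2.
Qed.

(** Both the sequence and its adjoints converge pointwise; the two limits are adjoint to each other,
    so the limit is again an operator of the algebra. *)
Fact aop_complete (u : nat -> aop) : ncauchy aop_nrm u -> nconverges aop_nrm u.
Proof.
have lim (v : nat -> aop) : ncauchy aop_nrm v ->
    exists l : H -> H, forall x e, 0 < e -> exists n0, forall n, (n0 <= n)%N -> hn (v n x - l x) < e.
  move=> Cv; have Cx x : ncauchy hn (fun n => v n x).
    move=> e e0; have x1 : 0 < hn x + 1 by rewrite ltr_wpDl ?hn_ge0.
    have [n0 h] := Cv _ (divr_gt0 e0 x1); exists n0 => m n hm hn'.
    have := h m n hm hn'; rewrite ltr_pdivlMr//; apply: le_lt_trans.
    apply: le_trans (aop_nrmP (v m - v n) x) _.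
    by rewrite ler_wpM2l ?aop_nrm_ge0// lerDl.
  by have /choice [l hl] x := hcomplete (Cx x); exists l.
move=> Cu.
have Cst : ncauchy aop_nrm (fun n => aop_st (u n)).
  move=> e e0; have [n0 h] := Cu e e0; exists n0 => m n hm hn'.
  have -> : aop_st (u m) - aop_st (u n) = aop_st (u m - u n).
    rewrite aop_stD; congr (_ + _); apply/esym/aop_eq/aop_stE.
    by apply: is_adjointN; exact: aop_stP.
  by rewrite aop_nrm_st h.
have [l hl] := lim u Cu; have [l' hl'] := lim _ Cst.
have ladj : is_adjoint HM l l'.
  move=> x y; apply: subr0_eq; apply: (@anorm_small_eq0 _ _ CA _ (hn x + hn y)).
    by rewrite addr_ge0 ?hn_ge0.
  move=> e e0; have [n1 h1] := hl x e e0; have [n2 h2] := hl' y e e0.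
  set n := maxn n1 n2.
  have -> : ip (l x) y - ip x (l' y) = ip x (aop_st (u n) y - l' y) - ip (u n x - l x) y.
    by rewrite ipBr ipBl (aop_stP (u n)) opprB [RHS]addrC addrA subrK.
  apply: le_trans (anormB _ _ _) _.
  have := cauchy_schwarz x (aop_st (u n) y - l' y).
  have := cauchy_schwarz (u n x - l x) y.
  have := h1 n (leq_maxl _ _); have := h2 n (leq_maxr _ _).
  have := hn_ge0 x; have := hn_ge0 y.
  move: (hn _) (hn _) (hn _) (hn _) (anorm _ _) (anorm _ _) => *; nra.
exists (Aop (ex_intro _ _ ladj)) => e e0.
have e20 : 0 < e / 2 by rewrite divr_gt0.
have [n0 h] := Cu _ e20; exists n0 => n hn'.
apply: (@le_lt_trans _ _ (e / 2)); last by lra.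
apply: aop_nrm_le => [|x]; first exact: ltW.
(* For fixed x compare with a later [u m], where m may depend on x: the distance from [u n] to [u m]
   is below e / 2 uniformly in x. *)
change (hn (u n x - l x) <= e / 2 * hn x).
apply: (@le_of_forall_eps _ _ _ 1) => // e' e'0; rewrite mul1r.
have [n1 h1] := hl x e' e'0; set m := maxn n0 n1.
have := h1 m (leq_maxr _ _); have := h n m hn' (leq_maxl _ _).
have : hn (u n x - u m x) <= _ := aop_nrmP (u n - u m) x; have := hn_ge0 x.
have := hnD (u n x - u m x) (u m x - l x); rewrite addrA subrK.
move: (hn _) (hn _) (hn _) (hn _) (aop_nrm _) => *; nra.
Qed.

Definition aop_ucstar : ucstar R aop :=
  UCstar aop_stK aop_stD aop_stM aop_st_scr aop_st_im aop_scr_comm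
    (aop_sc_comm 'i%C) aop_im_im aop_nrm_eq0 aop_nrmD aop_nrm_scM aop_nrmM
    aop_nrm_cstar aop_complete.

End NormedOperators.
End AdjointableOperators.

(** * The Cauchy-Schwarz inequality *)

Section CauchySchwarz.
Variables (R : realType) (A : lmodType R[i]) (CA : cstar_algebra R A).

Lemma sqrt_anorm_star_mul a : Num.sqrt (anorm CA (amul CA (astar CA a) a)) = anorm CA a.
Proof. by rewrite anorm_cstar sqrtr_sqr ger0_norm// anorm_ge0. Qed.

Fact self_ip_eq0 a : amul CA (astar CA a) a = 0 -> a = 0.
Proof.
move=> E; apply: (@anorm_eq0 _ _ CA).
by rewrite -sqrt_anorm_star_mul E anorm0 sqrtr0.
Qed.

Fact self_complete (u : nat -> A) :
  ncauchy (fun x => Num.sqrt (anorm CA (amul CA (astar CA x) x))) u ->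
  nconverges (fun x => Num.sqrt (anorm CA (amul CA (astar CA x) x))) u.
Proof.
have -> : (fun x => Num.sqrt (anorm CA (amul CA (astar CA x) x))) = anorm CA.
  exact/funext/sqrt_anorm_star_mul.
exact: acomplete.
Qed.

(* Left multiplications embed [A] isometrically into the unital algebra of adjointable
   operators on [A], which thus serves as a unitization. *)
Definition self_module : hilbert_module R A CA A.
Proof.
apply: (@HilbertModule _ _ CA A (amul CA) (fun a b => amul CA (astar CA a) b)).
- exact: amulDl.
- exact: amulDr.
- by move=> x a b; rewrite amulA.
- exact: amulZl.
- exact: amulZr.
- by move=> x y z; rewrite amulDr.
- by move=> c x y; rewrite amulZr.
- by move=> x y a; rewrite amulA.
- by move=> x y; rewrite astarM astarK.
- by move=> x; exists x.
- exact: self_ip_eq0.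
- exact: self_complete.
Defined.

Lemma hn_self a : hn self_module a = anorm CA a.
Proof. exact: sqrt_anorm_star_mul. Qed.

Lemma self_cauchy_schwarz (x y : A) :
  anorm CA (ip self_module x y) <= hn self_module x * hn self_module y.
Proof. by rewrite !hn_self /= (le_trans (anormM _ _ _))// anorm_star. Qed.

Local Notation U := (aop_ucstar self_cauchy_schwarz).

Fact is_adjoint_lmul a : is_adjoint self_module (amul CA a) (amul CA (astar CA a)).
Proof. by move=> x y /=; rewrite astarM amulA. Qed.

Definition lmul a : aop self_module := Aop (ex_intro _ _ (is_adjoint_lmul a)).

Lemma lmul_star a : lmul (astar CA a) = st U (lmul a).
Proof. by apply/esym/aop_eq/aop_stE; exact: is_adjoint_lmul. Qed.

Lemma lmulM a b : lmul (amul CA a b) = lmul a * lmul b.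
Proof. by apply/aop_eq/funext => x; rewrite /= -amulA. Qed.

Lemma lmulD a b : lmul (a + b) = lmul a + lmul b.
Proof. by apply/aop_eq/funext => x /=; rewrite amulDl. Qed.

Lemma lmulZ r a : lmul ((r%:C)%C *: a) = sc U r * lmul a.
Proof. by apply/aop_eq/funext => x /=; rewrite amulZl. Qed.

Lemma lmulN a : lmul (- a) = - lmul a.
Proof. by apply/aop_eq/funext => x /=; rewrite amulNl. Qed.

(** The lower bound comes from evaluating at [astar CA a], by the C*-identity. *)
Lemma nrm_lmul a : nrm U (lmul a) = anorm CA a.
Proof.
have le b : nrm U (lmul b) <= anorm CA b.
  apply: aop_nrm_le => [|x]; first exact: anorm_ge0.
  by rewrite !hn_self anormM.
apply/eqP; rewrite eq_le le/=.
have := aop_nrmP self_cauchy_schwarz (lmul a) (astar CA a).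
rewrite !hn_self anorm_star /= -[X in amul CA X _](astarK CA a) anorm_cstar anorm_star expr2.
have [->|n0] := eqVneq (anorm CA a) 0; first by move=> _; exact: aop_nrm_ge0 self_cauchy_schwarz _.
by rewrite ler_pM2r// lt_def n0 anorm_ge0.
Qed.

Variables (H : lmodType R[i]) (HM : hilbert_module R A CA H).
Local Notation ip := (ip HM).
Local Notation hn := (hn HM).

Lemma pos_lmul_ip x : pos U (lmul (ip x x)).
Proof. by have [b ->] := ip_pos HM x; rewrite lmulM lmul_star; exact: pos_st_mul. Qed.

Lemma ip_ractl x y a : ip (ract HM x a) y = amul CA (astar CA a) (ip x y).
Proof. by rewrite -ip_star ipMr astarM ip_star. Qed.

(* Expand [0 <= <z, z>] for [z = x <x, y> - |x|^2 y], using [<x, x> <= |x|^2] *)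
Lemma ip_cauchy_schwarz x y : anorm CA (ip x y) <= hn x * hn y.
Proof.
have [/hn_eq0 ->|x0] := eqVneq (hn x) 0; first by rewrite ip0l anorm0 mulr_ge0 ?hn_ge0.
set p := ip x x; set a := ip x y; set K := hn x ^+ 2; set M := hn y ^+ 2.
have K0 : 0 < K by rewrite exprn_gt0// lt_def x0 hn_ge0.
have M0 : 0 <= M by rewrite exprn_ge0// hn_ge0.
have LpK : nrm U (lmul p) = K by rewrite nrm_lmul -hn_sq.
have LyM : nrm U (lmul (ip y y)) = M by rewrite nrm_lmul -hn_sq.
set z := ract HM x a - (K%:C)%C *: y.
set L := lmul a.
have zE : lmul (ip z z) = st U L * lmul p * L - sc U K * (st U L * L)
    - sc U K * (st U L * L) + sc U (K * K) * lmul (ip y y).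
  have -> : ip z z = amul CA (amul CA (astar CA a) p) a - (K%:C)%C *: amul CA (astar CA a) a
      - (K%:C)%C *: amul CA (astar CA a) a + ((K * K)%:C)%C *: ip y y.
    rewrite /z ipBl !ipBr !ip_ractl !ipMr !ipZr !ipZl amulZr.
    have -> : ((K%:C)%C : R[i])^* = (K%:C)%C by exact: conjc_real.
    have -> : ip y x = astar CA a by rewrite ip_star.
    have -> : ((K * K)%:C)%C = ((K%:C)%C * (K%:C)%C) :> R[i] by rewrite rmorphM.
    by rewrite -[_ *: ip y y in RHS]scalerA amulZl opprB amulA [LHS]addrA addrAC.
  by rewrite !lmulD !lmulN !lmulZ !lmulM lmul_star.
have pz := pos_lmul_ip z; have py := pos_lmul_ip y.
have [ps _] := pos_lmul_ip x; have [ys _] := py.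
have pK : pos U (st U L * (sc U K - lmul p) * L).
  by apply: pos_conj; apply: pos_subr_sc => //; rewrite -/p LpK.
have : nrm U (sc U K * (st U L * L)) <= K * K * M.
  apply: nrm_le_of_pos; first exact: mulr_ge0 (mulr_ge0 (ltW K0) (ltW K0)) M0.
    by apply: pos_scM; [exact: ltW | exact: pos_st_mul].
  (* The terms in <y, y> cancel, as do those in <x, x>, and of the two cross terms in <z, z> one is
     absorbed by the last summand. *)
  have -> : sc U (K * K * M) - sc U K * (st U L * L) =
      sc U (K * K) * (sc U M - lmul (ip y y)) + (lmul (ip z z) + st U L * (sc U K - lmul p) * L).
    rewrite zE [sc U (K * K * M)]rmorphM/= [st U L * (_ - _)]mulrBr -[st U L * sc U K]sc_comm.
    by ncring.
  apply: posD; last exact: posD.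
  apply: pos_scM; first by rewrite mulr_ge0 ?ltW.
  by apply: pos_subr_sc => //; rewrite LyM.
rewrite nrm_scM nrm_cstar gtr0_norm// nrm_lmul -mulrA ler_pM2l// /K /M -exprMn.
by rewrite ler_sqr ?nnegrE ?anorm_ge0 ?mulr_ge0 ?hn_ge0.
Qed.

End CauchySchwarz.

(** * The matched projection *)

Section MatchedProjection.
Variables (R : realType) (B : pzRingType) (U : ucstar R B).
Local Notation st := (st U).
Local Notation sc := (sc U).

(** Since a is self-adjoint, [st p] satisfies the same four equations as p, and the uniqueness
    argument for Moore-Penrose inverses applies. *)
Lemma MP_inverse_sa (a p : B) : st a = a -> a * (p * a) = a -> p * (a * p) = p ->
  st (a * p) = a * p -> st (p * a) = p * a -> st p = p.
Proof.
move=> as_ apa pap sap spa.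
have E1 : st p * a = a * p by rewrite -sap stM as_.
have E2 : a * st p = p * a by rewrite -spa stM as_.
have apa' : a * (st p * a) = a by have := congr1 st apa; rewrite !stM as_ -mulrA.
have apC : a * p = p * a.
  by rewrite -[X in X * p]apa' mulrA E2 -mulrA -E1 -mulrA apa'.
by rewrite -{1}pap !stM as_ E1 apC -mulrA E2 -apC pap.
Qed.

Section Formula.
Variables (q a p y : B).
Hypotheses (qq : q * q = q) (pos_a : pos U a) (aa : a * a = q * st q).
Hypotheses (apa : a * (p * a) = a) (pap : p * (a * p) = p)
  (sap : st (a * p) = a * p) (spa : st (p * a) = p * a).
Hypotheses (ya1 : y * (a + 1) = 1) (a1y : (a + 1) * y = 1).

Let qs := st q.
(** The projection onto the range of q, by [qe] and [eq_] below. *)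
Let e := a * p.
Let S := q + qs.
(** Twice the matched projection, so that M - 1 is the reflection J. *)
Let M := (a + qs) * (p * (y * (a + q))).

Let as_ : st a = a. Proof. by case: pos_a. Qed.
Let ps : st p = p. Proof. exact: MP_inverse_sa apa pap sap spa. Qed.
Let apC : a * p = p * a. Proof. by rewrite -{1}sap stM as_ ps. Qed.
Let qsqs : qs * qs = qs. Proof. by rewrite -stM qq. Qed.

(** Multiplied on the left by its adjoint, a (1 - [qs]) gives (1 - q) a ^ 2 (1 - [qs]), which
    vanishes since a ^ 2 = q [qs]. The lemma [eq_] uses the same device. *)
Let aqs : a * qs = a.
Proof.
have : a * (1 - qs) = 0.
  apply: (@st_mul_eq0 _ _ U); rewrite stM stB st1 stK as_.
  by rewrite -mulrA [a * (a * _)]mulrA aa !mulrA mulrBl mul1r qq subrr !mul0r.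
by rewrite mulrBr mulr1 => /subr0_eq.
Qed.

Let qa : q * a = a. Proof. by rewrite -[RHS]as_ -{2}aqs stM stK as_. Qed.

Let es : st e = e. Proof. exact: sap. Qed.
Let ea : e * a = a. Proof. by rewrite -mulrA apa. Qed.
Let qe : q * e = e. Proof. by rewrite mulrA qa. Qed.
Let eqs : e * qs = e. Proof. by rewrite -[RHS]es -[X in _ = st X]qe stM es. Qed.
Let ee : e * e = e. Proof. by rewrite /e -mulrA pap. Qed.

Let eq_ : e * q = q.
Proof.
have : st ((1 - e) * q) = 0.
  apply: (@st_mul_eq0 _ _ U); rewrite stK stM stB st1 es -/qs.
  by rewrite -mulrA [q * (qs * _)]mulrA -aa !mulrA mulrBl mul1r ea subrr !mul0r.
by move=> /(congr1 st); rewrite stK st0 mulrBl mul1r => /subr0_eq/esym.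
Qed.

Let qse : qs * e = qs. Proof. by rewrite -[RHS]/(st q) -eq_ stM es. Qed.

Let ys : st y = y.
Proof.
have sy1 : st y * (a + 1) = 1 by rewrite -{1}as_ -{1}(st1 U) -stD -stM a1y st1.
by rewrite -[LHS]mulr1 -a1y mulrA sy1 mul1r.
Qed.

Let ya : y * a = 1 - y. Proof. by rewrite -ya1 mulrDr mulr1 addrK. Qed.
Let ay : a * y = 1 - y. Proof. by rewrite -a1y mulrDl mul1r addrK. Qed.

Let yp : y * p = p * y.
Proof.
have h : p * (a + 1) = (a + 1) * p by rewrite mulrDr mulrDl apC mulr1 mul1r.
by rewrite -[LHS]mulr1 -a1y -mulrA [p * _]mulrA h -!mulrA mulrA ya1 mul1r.
Qed.

Let ye : y * e = e * y.
Proof. by rewrite /e mulrA ya -mulrA -yp mulrA ay. Qed.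

(** Off the range of q, a vanishes and y is the identity: (1 - e) a = 0 and a y = 1 - y. *)
Let e1y : e * y = e - 1 + y.
Proof.
have : (1 - e) * (a * y) = 0 by rewrite mulrA mulrBl mul1r ea subrr mul0r.
rewrite ay => h; apply/eqP; rewrite -subr_eq0 -h; apply/eqP; ncring.
Qed.

Let ME : M = 1 - y + y * q + qs * y + qs * (p * (y * q)).
Proof.
have -> : M = a * p * (y * a) + a * p * y * q + qs * p * (y * a) + qs * (p * (y * q)).
  by rewrite /M; ncring.
rewrite -/e -[e * y]ye -[y * e * q]mulrA eq_ -mulrA.
have -> : e * (y * a) = 1 - y by rewrite mulrA -ye -mulrA ea.
have -> : qs * (p * (y * a)) = qs * y by rewrite ya -ay [p * _]mulrA -apC mulrA qse.
by [].
Qed.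

(** Moving S past a + [qs] produces the factor a + 1, which cancels y. *)
Let SM : S * M = (a + qs) * (p * (a + q)).
Proof.
have h : S * (a + qs) = (a + qs) * (a + 1).
  by rewrite /S mulrDl !mulrDr qa -aa qsqs mulrDl !mulr1; ncring.
rewrite /M mulrA h -!mulrA; congr (_ * _).
by rewrite [p * (y * _)]mulrA -yp -mulrA mulrA [(a + 1) * _]a1y mul1r.
Qed.

Let Ms : st M = M.
Proof.
by rewrite /M !stM !stD as_ ps ys [st qs]stK -/qs -!mulrA [y * (p * _)]mulrA yp -!mulrA.
Qed.

Let SMC : M * S = S * M.
Proof.
have SMs : st (S * M) = S * M.
  by rewrite SM !stM !stD as_ ps stK -/qs mulrA.
by rewrite -SMs stM Ms /S stD stK addrC.
Qed.

Let MM : M * M = M + M.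
Proof.
have h : (a + q) * (a + qs) = (a + 1) * (a + a).
  by rewrite mulrDl !mulrDr qa aqs -aa mulrDl; ncring.
have -> : M * M = (a + qs) * (p * (y * ((a + q) * (a + qs) * (p * (y * (a + q)))))).
  by rewrite /M !mulrA.
rewrite h -!mulrA [y * (_ * _)]mulrA ya1 mul1r.
have -> : p * ((a + a) * (p * (y * (a + q)))) = (p * (a * p) + p * (a * p)) * (y * (a + q)) by ncring.
by rewrite pap /M; ncring.
Qed.

(** [z1] and [z2] are the candidates for |S| and |2 - S|; [z1] is S (M - 1) in a form that shows its
    positivity. *)
Let z1 := a + qs * p * q.
Let z2 := z1 + (1 + 1) - (M + M).

Let z1E : z1 = S * (M - 1).
Proof.
rewrite mulrBr SM mulr1.
have -> : (a + qs) * (p * (a + q)) = a * (p * a) + e * q + qs * (p * a) + qs * p * q by rewrite /e; ncring.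
by rewrite apa eq_ -apC qse /z1 /S; ncring.
Qed.

Let pos_p : pos U p.
Proof. by rewrite -pap mulrA -{1}ps; exact: pos_conj. Qed.

Let pos_y : pos U y.
Proof.
have -> : y = st y * (a + 1) * y by rewrite -mulrA a1y mulr1 ys.
apply: pos_conj; apply: posD => //.
by rewrite -(rmorph1 sc); exact: pos_sc.
Qed.

Let pos_z1 : pos U z1.
Proof. by apply: posD => //; exact: pos_conj. Qed.

(** Write z2 = (2 - M) + (z1 - M). The first term is half its own square. The second is (a - e) +
    [st (1 - q)] e y e (1 - q), where a - e = (a ^ 2 - e) y is a product of commuting positive
    elements because a ^ 2 - e = (q - e) [st (q - e)]. *)
Let pos_z2 : pos U z2.
Proof.
have -> : z2 = sc 2^-1 * ((1 + 1 - M) * (1 + 1 - M)) + ((a * a - e) * y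
    + st (1 - q) * (st e * y * e) * (1 - q)).
  have -> : (1 + 1 - M) * (1 + 1 - M) = (1 + 1 - M) + (1 + 1 - M).
    rewrite mulrBl !mulrBr MM; ncring.
  rewrite sc_half.
  have -> : (a * a - e) * y = a - e.
    have -> : a * a - e = (a - e) * (a + 1) by rewrite mulrBl !mulrDr ea !mulr1; ncring.
    by rewrite -mulrA a1y mulr1.
  have -> : st e * y * e = e * y by rewrite es -ye -mulrA ee ye.
  rewrite stB st1 -/qs.
  have -> : (1 - qs) * (e * y) * (1 - q) = e * y - y * q - qs * y + qs * y * q.
    rewrite mulrBl mulrBr mul1r mulr1 [qs * (e * y)]mulrA qse.
    have <- : e * y * q = y * q by rewrite -ye -mulrA eq_.
    by ncring.
  rewrite e1y /z2 /z1.
  have -> : qs * p * q = qs * (p * (y * q)) + qs * y * q.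
    have -> : qs * y * q = qs * (p * ((1 - y) * q)); last by ncring.
    by rewrite -ay !mulrA -[qs * p * a]mulrA -apC qse.
  rewrite {2}ME; ncring.
apply: posD; last apply: posD.
- apply: pos_scM; first by rewrite invr_ge0.
  by apply: pos_sq; rewrite stB stD st1 Ms.
- have h : a * a - e = st (st (q - e)) * st (q - e).
    by rewrite stK stB es mulrBl !mulrBr -aa qe eqs ee; ncring.
  apply: posM => //; first by rewrite h; exact: pos_st_mul.
  have aay : a * a * y = y * (a * a).
    by rewrite -mulrA ay mulrA ya mulrBl mulrBr mul1r mulr1 ay ya.
  by rewrite mulrBl mulrBr ye aay.
- by do 2! apply: pos_conj.
Qed.

Lemma matched_projection_eq b1 b2 : pos U b1 -> pos U b2 ->
  b1 * b1 = (q + st q) * (q + st q) ->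
  b2 * b2 = (sc 2 - (q + st q)) * (sc 2 - (q + st q)) ->
  sc 2^-1 * ((a + st q) * (p * (y * (a + q)))) = sc 4^-1 * (sc 2 + b1 - b2).
Proof.
move=> pb1 pb2 b1E b2E.
have sc2 : sc 2 = 1 + 1 by rewrite rmorph_nat mulr2n.
rewrite -/qs -/S in b1E b2E.
have MS1 : (M - 1) * S = S * (M - 1) by rewrite mulrBl mulrBr SMC mul1r mulr1.
have JJ : (M - 1) * (M - 1) = 1 by rewrite mulrBl !mulrBr MM; ncring.
have -> : b1 = z1.
  apply: (pos_sqrt_uniq pb1 pos_z1).
  by rewrite b1E z1E -mulrA [(M - 1) * _]mulrA MS1 -mulrA JJ mulr1.
have z2E : z2 = (S - (1 + 1)) * (M - 1) by rewrite /z2 z1E; ncring.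
have -> : b2 = z2.
  apply: (pos_sqrt_uniq pb2 pos_z2).
  have MS2 : (M - 1) * (S - (1 + 1)) = (S - (1 + 1)) * (M - 1).
    by rewrite mulrBr mulrBl MS1; ncring.
  by rewrite b2E z2E -mulrA [(M - 1) * _]mulrA MS2 -mulrA JJ mulr1 sc2; ncring.
have -> : sc 2 + z1 - z2 = sc 2 * M by rewrite sc2M sc2 /z2; ncring.
have s42 : sc 4^-1 * sc 2 = sc 2^-1 by rewrite -rmorphM/=; congr (sc _); field.
by rewrite [RHS]mulrA s42.
Qed.

End Formula.
End MatchedProjection.

(** * Transfer of the formula to operators on a Hilbert module *)

Theorem theorem3p2 (R : realType) (A : lmodType R[i]) (CA : cstar_algebra R A)
  (H : lmodType R[i]) (HM : hilbert_module R A CA H)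
  (Q Qs : H -> H) (hQs : is_adjoint HM Q Qs) (hQQ : opmul Q Q = Q)
  (AQs : H -> H) (hAQs : is_abs HM Qs Q AQs)            (* AQs = |Q^star| *)
  (P : H -> H) (hP : is_MP_inverse HM AQs P)             (* P = |Q^star|^+ *)
  (Y : H -> H) (hY : is_inverse HM (opadd AQs opI) Y)    (* Y = (|Q^star| + I)^{-1} *)
  (B1 : H -> H) (hB1 : is_abs HM (opadd Q Qs) (opadd Q Qs) B1)   (* B1 = |Q + Q^star| *)
  (B2 : H -> H)
  (hB2 : is_abs HM (opsub (opscale 2%:R opI) (opadd Q Qs))
                   (opsub (opscale 2%:R opI) (opadd Q Qs)) B2)  (* B2 = |2I - (Q + Q^star)| *)
  : matched_proj_expr Q Qs AQs P Y =
    opscale (4%:R^-1) (opsub (opadd (opscale 2%:R opI) B1) B2).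
Proof.
pose U := aop_ucstar (ip_cauchy_schwarz HM).
(* Positivity given as a factorization becomes the norm notion [pos] through [pos_st_mul]. *)
have abs_pos T Ts X : is_abs HM T Ts X ->
    exists x : aop HM, [/\ afun x = X, pos U x & opmul X X = opmul Ts T].
  move=> [[S [Ss [hS ->]]] E].
  pose s : aop HM := Aop (ex_intro (is_adjoint HM S) Ss hS).
  have sE : afun (st U s * s) = opmul Ss S by rewrite -(aop_stE (f := s) hS).
  by exists (st U s * s); split => //; exact: pos_st_mul.
have [a [aE pa a2]] := abs_pos _ _ _ hAQs.
have [b1 [b1E pb1 b12]] := abs_pos _ _ _ hB1.
have [b2 [b2E pb2 b22]] := abs_pos _ _ _ hB2.
have [Padj APA PAP APs PAs] := hP; have [Yadj YA AY] := hY.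
pose q : aop HM := Aop (ex_intro (is_adjoint HM Q) Qs hQs).
pose p : aop HM := Aop Padj; pose y : aop HM := Aop Yadj.
have qsE : afun (st U q) = Qs := aop_stE (f := q) hQs.
subst AQs B1 B2.
have two : afun (sc U 2) = opscale 2%:R opI.
  by rewrite /= rmorph_nat.
have fourV : afun (sc U 4^-1) = opscale (4%:R^-1) opI.
  by rewrite /= fmorphV rmorph_nat.
have twoV : afun (sc U 2^-1) = opscale (2%:R^-1) opI.
  by rewrite /= fmorphV rmorph_nat.
have qq : q * q = q by exact: aop_eq.
have aa : a * a = q * st U q by apply: aop_eq; rewrite [LHS]a2 -qsE.
have apa : a * (p * a) = a by exact: aop_eq.
have pap : p * (a * p) = p by exact: aop_eq.
have sap : st U (a * p) = a * p by apply/aop_eq/aop_stE.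
have spa : st U (p * a) = p * a by apply/aop_eq/aop_stE.
have ya1 : y * (a + 1) = 1 by exact: aop_eq.
have a1y : (a + 1) * y = 1 by exact: aop_eq.
have h1 : b1 * b1 = (q + st U q) * (q + st U q).
  by apply: aop_eq; rewrite [LHS]b12 -qsE.
have h2 : b2 * b2 = (sc U 2 - (q + st U q)) * (sc U 2 - (q + st U q)).
  by apply: aop_eq; rewrite [LHS]b22 -qsE -two.
have := matched_projection_eq qq pa aa apa pap sap spa ya1 a1y pb1 pb2 h1 h2.
move/(congr1 (fun f : aop HM => f : H -> H)) => E.
(* Scaling an operator is, by conversion, multiplication by a scalar operator, which matches the
   form of E. *)
rewrite -[LHS]/(opmul (opscale 2%:R^-1 opI) (opmul (opadd a Qs) (opmul P (opmul Y (opadd a Q))))).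
rewrite -[RHS]/(opmul (opscale 4%:R^-1 opI) (opsub (opadd (opscale 2%:R opI) b1) b2)).
by rewrite -twoV -fourV -two -qsE.
Qed.
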